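(* There exist a finite set $\Sigma$ of dependencies that is simultaneously acyclic, full, guarded and sticky, and a safe Boolean conjunctive query $q$, such that deciding, given a database $\mathcal{D}$, whether $\langle\Sigma,\mathcal{D}\rangle$ AR-entails $q$ is coNP-hard with respect to data complexity. In particular, AR-entailment of safe BUCQs is coNP-hard in data complexity for acyclic+full+guarded+sticky dependencies.
   Context: A signature is a set of predicate symbols with arities, always containing a special 0-ary predicate $\bot$. A term is a constant or a variable; a (predicate) atom is $p(t_1,\dots,t_n)$; an inequality is $t\neq t'$. A database is a finite set of ground atoms (facts) not containing $\bot$. A conjunction with inequalities is a conjunction of at least one predicate atom or inequality. A CQ is $\exists\vec y\,\gamma$ with $\gamma$ a conjunction with inequalities; it is safe if every variable occurs in a predicate atom; a UCQ is a finite disjunction of CQs; a safe BUCQ is a UCQ without free variables all of whose CQs are safe. A dependency is a first-order sentence $\forall\vec x\,(\gamma\rightarrow Q')$ where $\gamma$ (the body) is a conjunction with inequalities whose variables are in $\vec x$, each occurring in some predicate atom of $\gamma$, and $Q'$ (the head) is a UCQ whose free variables are among $\vec x$ and in which every existentially quantified variable of each disjunct occurs in a predicate atom of that disjunct. A dependency is full if its head is a single CQ all of whose variables occur in the body; guarded if some atom of its body contains all body variables. The dependency graph of $\Sigma$ has an edge from $\tau_1$ to $\tau_2$ iff the head of $\tau_1$ contains an atom whose predicate appears in a predicate atom of the body of $\tau_2$; $\Sigma$ is acyclic if it has no cycle. Stickiness: assume distinct dependencies use distinct variables; a variable $x$ in the body of $\tau\in\Sigma$ is marked if (i) some atom of the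 head of $\tau$ does not contain $x$, or (ii) there are $\tau'\in\Sigma$ and a predicate $p$ such that the head of $\tau$ contains $p(\vec t)$, the body of $\tau'$ contains $p(\vec t')$, and whenever $x$ is the $i$-th term of $\vec t$ the $i$-th term of $\vec t'$ is a marked variable (inductive definition); $\Sigma$ is sticky if every marked variable occurs at most once in the body of its dependency. $\mathcal{D}$ is consistent with $\Sigma$ if $\mathcal{D}$ satisfies every dependency of $\Sigma$. A repair of $\langle\Sigma,\mathcal{D}\rangle$ is an inclusion-maximal subset of $\mathcal{D}$ consistent with $\Sigma$. AR-entailment of $q$: $q$ holds in every repair. Data complexity: $\Sigma$ and the query fixed, database is the input. *)

(* Defs.v *)
From Stdlib Require List.
From mathcomp Require Import all_boot.
Set Implicit Arguments. Unset Strict Implicit. Unset Printing Implicit Defensive.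

Inductive move := MoveL | MoveR | MoveS.

(* Deterministic single-tape TM on a bi-infinite tape, finite state set
   and finite tape alphabet.  Inputs are bit strings; [tm_in] writes the
   input bits, [tm_out] reads output bits (blank is not an output bit). *)
Record TM := {
  tm_state : finType;
  tm_sym   : finType;
  tm_blank : tm_sym;
  tm_in    : bool -> tm_sym;
  tm_out   : tm_sym -> option bool;
  tm_out_blank : tm_out tm_blank = None;
  tm_start : tm_state;
  tm_halt  : tm_state -> bool;
  tm_delta : tm_state -> tm_sym -> tm_state * tm_sym * move }.

(* configuration: state, left part (reversed, nearest cell first),
   scanned symbol, right part *)
Definition config (M : TM) :=
  (tm_state M * seq (tm_sym M) * tm_sym M * seq (tm_sym M))%type.

Definition tm_init (M : TM) (x : seq bool) : config M :=
  match x with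
  | [::] => (@tm_start M, [::], @tm_blank M, [::])
  | b :: bs => (@tm_start M, [::], @tm_in M b, map (@tm_in M) bs)
  end.

Definition tm_step (M : TM) (c : config M) : config M :=
  let: (q, l, a, r) := c in
  if @tm_halt M q then c else
  let: (q', a', m) := @tm_delta M q a in
  match m with
  | MoveS => (q', l, a', r)
  | MoveL => match l with
             | [::] => (q', [::], @tm_blank M, a' :: r)
             | b :: l' => (q', l', b, a' :: r)
             end
  | MoveR => match r with
             | [::] => (q', a' :: l, @tm_blank M, [::])
             | b :: r' => (q', a' :: l, b, r')
             end
  end.

Fixpoint read_bits (M : TM) (s : seq (tm_sym M)) : seq bool :=
  match s with
  | [::] => [::]
  | a :: s' => match @tm_out M a with
               | Some b => b :: @read_bits M s'
               | None => [::]
               end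
  end.

Definition tm_output (M : TM) (c : config M) : seq bool :=
  let: (_, _, a, r) := c in @read_bits M (a :: r).

Definition tm_halted (M : TM) (c : config M) : bool :=
  let: (q, _, _, _) := c in @tm_halt M q.

Definition computes_in (M : TM) (f : seq bool -> seq bool) (T : nat -> nat) :=
  forall x, exists n, n <= T (size x) /\
    @tm_halted M (iter n (@tm_step M) (tm_init M x)) /\
    @tm_output M (iter n (@tm_step M) (tm_init M x)) = f x.

Definition polytime (f : seq bool -> seq bool) : Prop :=
  exists (M : TM) (k : nat), computes_in M f (fun n => n ^ k + k).

Definition in_P (L : seq bool -> Prop) : Prop :=
  exists f, polytime f /\ forall x, L x <-> f x = [:: true].

(* self-delimiting pairing of bit strings *)
Definition pair_enc (x y : seq bool) : seq bool :=
  flatten [seq [:: b; b] | b <- x] ++ [:: false; true] ++ y.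

Definition in_NP (L : seq bool -> Prop) : Prop :=
  exists (V : seq bool -> Prop) (k : nat), in_P V /\
    forall x, L x <-> exists y, size y <= size x ^ k + k /\ V (pair_enc x y).

Definition in_coNP (L : seq bool -> Prop) : Prop :=
  in_NP (fun x => ~ L x).

Definition coNP_hard (A : Type) (adm : A -> Prop) (P : A -> Prop)
    (enc : A -> seq bool) : Prop :=
  forall L, in_coNP L ->
    exists f : seq bool -> A,
      polytime (fun x => enc (f x)) /\
      (forall x, adm (f x)) /\
      (forall x, L x <-> P (f x)).

(* predicate symbols and constants and variables are natural numbers *)
(* a term is a constant (inl c) or a variable (inr v) *)
Definition term := (nat + nat)%type.

Inductive lit :=
  | LAtom of nat & seq term
  | LNeq  of term & term.

(* the special 0-ary predicate bottom is the predicate symbol 0 *)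
Definition bot : nat := 0.

(* signature: list of (predicate symbol, arity); must contain (bot,0) *)
Definition signature := seq (nat * nat).
Definition wf_sig (S : signature) : Prop :=
  uniq (map fst S) /\ (bot, 0) \in S.

Definition fact := (nat * seq nat)%type.
Definition database := seq fact.

Definition wf_db (S : signature) (D : database) : Prop :=
  forall f, f \in D -> (f.1, size f.2) \in S /\ f.1 != bot.

(* CQ  exists cq_ex, /\ cq_body *)
Record cq := { cq_ex : seq nat; cq_body : seq lit }.
(* dependency  forall x, /\ d_body -> \/ d_head *)
Record dep := { d_body : seq lit; d_head : seq cq }.

Definition tvars (t : term) : seq nat :=
  match t with inl _ => [::] | inr v => [:: v] end.
Definition terms_vars (ts : seq term) : seq nat := flatten (map tvars ts).
Definition lit_terms (l : lit) : seq term :=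
  match l with LAtom _ ts => ts | LNeq t t' => [:: t; t'] end.
Definition conj_terms (g : seq lit) : seq term := flatten (map lit_terms g).
Definition conj_vars (g : seq lit) : seq nat := terms_vars (conj_terms g).

Definition in_some_atom (g : seq lit) (v : nat) : Prop :=
  exists p ts, List.In (LAtom p ts) g /\ v \in terms_vars ts.

Definition wf_lit (S : signature) (l : lit) : Prop :=
  match l with LAtom p ts => (p, size ts) \in S | LNeq _ _ => True end.

Definition wf_conj (S : signature) (g : seq lit) : Prop :=
  g <> [::] /\ forall l, List.In l g -> wf_lit S l.

Definition wf_dep (S : signature) (t : dep) : Prop :=
  wf_conj S (d_body t) /\
  (forall v, v \in conj_vars (d_body t) -> in_some_atom (d_body t) v) /\
  d_head t <> [::] /\
  forall c, List.In c (d_head t) ->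
    wf_conj S (cq_body c) /\
    (forall v, v \in conj_vars (cq_body c) -> v \notin cq_ex c ->
        v \in conj_vars (d_body t)) /\
    (forall v, v \in cq_ex c -> v \in conj_vars (cq_body c) ->
        in_some_atom (cq_body c) v).

Definition safe_bcq (S : signature) (q : cq) : Prop :=
  wf_conj S (cq_body q) /\
  (forall v, v \in conj_vars (cq_body q) -> v \in cq_ex q) /\
  (forall v, v \in conj_vars (cq_body q) -> in_some_atom (cq_body q) v).

Definition eval_term (nu : nat -> nat) (t : term) : nat :=
  match t with inl c => c | inr v => nu v end.

Definition holds_lit (D : database) (nu : nat -> nat) (l : lit) : Prop :=
  match l with
  | LAtom p ts => (p, map (eval_term nu) ts) \in D
  | LNeq t t' => eval_term nu t <> eval_term nu t'
  end.

Definition holds_conj (D : database) (nu : nat -> nat) (g : seq lit) : Prop :=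
  forall l, List.In l g -> holds_lit D nu l.

Definition holds_cq (D : database) (nu : nat -> nat) (c : cq) : Prop :=
  exists nu' : nat -> nat,
    (forall v, v \notin cq_ex c -> nu' v = nu v) /\ holds_conj D nu' (cq_body c).

Definition sat_dep (D : database) (t : dep) : Prop :=
  forall nu, holds_conj D nu (d_body t) ->
    exists c, List.In c (d_head t) /\ holds_cq D nu c.

Definition consistent (Sigma : seq dep) (D : database) : Prop :=
  forall t, List.In t Sigma -> sat_dep D t.

Definition bq_holds (D : database) (q : cq) : Prop := holds_cq D (fun _ => 0) q.

Definition is_repair (Sigma : seq dep) (D R : database) : Prop :=
  {subset R <= D} /\ consistent Sigma R /\
  forall R', {subset R <= R'} -> {subset R' <= D} -> consistent Sigma R' ->
    {subset R' <= R}.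

Definition AR_entails (Sigma : seq dep) (D : database) (q : cq) : Prop :=
  forall R, is_repair Sigma D R -> bq_holds R q.

Definition full (t : dep) : Prop :=
  exists c, d_head t = [:: c] /\
    forall v, v \in conj_vars (cq_body c) ->
      v \in conj_vars (d_body t) /\ v \notin cq_ex c.

Definition guarded (t : dep) : Prop :=
  exists p ts, List.In (LAtom p ts) (d_body t) /\
    forall v, v \in conj_vars (d_body t) -> v \in terms_vars ts.

Definition lit_pred (l : lit) : seq nat :=
  match l with LAtom p _ => [:: p] | LNeq _ _ => [::] end.
Definition body_preds (t : dep) : seq nat := flatten (map lit_pred (d_body t)).
Definition head_preds (t : dep) : seq nat :=
  flatten (map (fun c => flatten (map lit_pred (cq_body c))) (d_head t)).

Definition dep0 : dep := {| d_body := [::]; d_head := [::] |}.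

Definition dep_edge (Sigma : seq dep) : rel 'I_(size Sigma) :=
  fun i j => has (fun p => p \in body_preds (nth dep0 Sigma j))
                 (head_preds (nth dep0 Sigma i)).

Definition acyclic (Sigma : seq dep) : Prop :=
  forall i j : 'I_(size Sigma),
    @dep_edge Sigma i j -> ~~ connect (@dep_edge Sigma) j i.

Definition head_atom (t : dep) (p : nat) (ts : seq term) : Prop :=
  exists c, List.In c (d_head t) /\ List.In (LAtom p ts) (cq_body c).
Definition body_atom (t : dep) (p : nat) (ts : seq term) : Prop :=
  List.In (LAtom p ts) (d_body t).

Definition term0 : term := inl 0.

(* marked i x : variable x of the i-th dependency is marked
   (variables of distinct dependencies are kept apart by the index i) *)
Inductive marked (Sigma : seq dep) : nat -> nat -> Prop :=
  | mark_base i x :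
      i < size Sigma -> x \in conj_vars (d_body (nth dep0 Sigma i)) ->
      (exists p ts, head_atom (nth dep0 Sigma i) p ts /\ x \notin terms_vars ts) ->
      marked Sigma i x
  | mark_prop i x j p ts ts' :
      i < size Sigma -> j < size Sigma ->
      x \in conj_vars (d_body (nth dep0 Sigma i)) ->
      head_atom (nth dep0 Sigma i) p ts ->
      body_atom (nth dep0 Sigma j) p ts' ->
      (forall k, k < size ts -> nth term0 ts k = inr x ->
         exists y, nth term0 ts' k = inr y /\ marked Sigma j y) ->
      marked Sigma i x.

Definition sticky (Sigma : seq dep) : Prop :=
  forall i x, marked Sigma i x ->
    count (fun t => t == inr x) (conj_terms (d_body (nth dep0 Sigma i))) <= 1.

Definition enc_nat (n : nat) : seq bool := nseq n true ++ [:: false].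
Definition enc_list (T : Type) (e : T -> seq bool) (s : seq T) : seq bool :=
  flatten [seq true :: e x | x <- s] ++ [:: false].
Definition enc_fact (f : fact) : seq bool := enc_nat f.1 ++ enc_list enc_nat f.2.
Definition enc_db (D : database) : seq bool := enc_list enc_fact D.

(* Main.v *)
(* The only rule lets two facts [pval i t a], [pval i t b] with [a <> b] and their guard [psep i t a b] derive
   a fact of a predicate absent from the databases, so it acts as a denial constraint while its head contains all
   variables: nothing is marked and the dependency graph has no edge. A repair chooses symbols for the cells of a
   space-time grid, at least one per cell by maximality, and the query holds iff some window of three cells and
   the cell below is forbidden. As the query is monotone, it fails in some repair iff the grid has a tableau of
   the verifier on the input paired with a guessed certificate, i.e. iff the complement of the language contains the input.
   The database is printed by a program with bounded loops over unary registers. The registers become tracks of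
   a single tape, and each elementary command is one walk from the leftmost cell and back. *)
From Stdlib Require Import Classical FunctionalExtensionality.
Require Import Defs.
From mathcomp Require Import all_boot zify.
Set Implicit Arguments. Unset Strict Implicit. Unset Printing Implicit Defensive.

(** * Loop programs and their compilation to Turing machines *)

(** The rules and the query are chosen before the language, so they cannot depend on the verifier:
    its transition table is data, listed negatively in [pforb], and the query only looks for a
    listed window. The natural constraint of one symbol per cell, [pval i t a], [pval i t b],
    [a <> b] with head bottom, is neither guarded nor sticky: no atom holds all four variables, and
    all are marked although [i] and [t] recur. The 4-ary guard and the 4-ary head cure both. The
    price is that a repair may drop a guard and keep several symbols in a cell; this only adds
    windows, so if the query fails there, it also fails for any selection of one surviving symbol
    per cell. A [TM] need not have [tm_in] injective or different from the blank, so the shape of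
    the guessed certificate cannot be checked on tape symbols; this is why row 0 has symbols of its
    own. *)

Definition state := ((nat -> nat) * seq bool)%type.

Definition setr (s : state) (r v : nat) : state :=
  (fun r' => if r' == r then v else s.1 r', s.2).
Definition appo (s : state) (bs : seq bool) : state := (s.1, s.2 ++ bs).

Inductive cmd :=
  | Skip
  | Inc of nat
  | Zero of nat
  | Out of bool
  | Seq of cmd & cmd
  | For of nat & nat & cmd
  | IfBit of nat & cmd & cmd.

Section Semantics.
Variable x : seq bool.

Definition incr (i : nat) (s : state) : state := setr s i (s.1 i).+1.

Fixpoint run (c : cmd) (s : state) : state :=
  match c with
  | Skip => s
  | Inc r => incr r s
  | Zero r => setr s r 0
  | Out b => appo s [:: b]
  | Seq c1 c2 => run c2 (run c1 s)
  | For i r c => setr (iter (s.1 r) (fun s' => incr i (run c s')) (setr s i 0)) i 0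
  | IfBit r c1 c2 => if nth false x (s.1 r) then run c1 s else run c2 s
  end.

Definition loop_state (i : nat) (c : cmd) (s : state) (j : nat) : state :=
  iter j (fun s' => incr i (run c s')) (setr s i 0).

(** Counts executed instructions of the compiled code. A loop round adds a test and an increment;
    the 3 stands for the first reset, the failing test and the last reset. The true branch of
    [IfBit] pays one more for the jump over the other branch. *)
Fixpoint cost (c : cmd) (s : state) : nat :=
  match c with
  | Skip => 0
  | Inc _ | Zero _ | Out _ => 1
  | Seq c1 c2 => cost c1 s + cost c2 (run c1 s)
  | For i r c => (\sum_(j < s.1 r) (cost c (loop_state i c s j) + 2)) + 3
  | IfBit r c1 c2 => if nth false x (s.1 r) then cost c1 s + 2 else cost c2 s + 1
  end.

End Semantics.

Fixpoint preserves (r : nat) (c : cmd) : bool :=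
  match c with
  | Skip | Out _ => true
  | Inc r' | Zero r' => r' != r
  | Seq c1 c2 | IfBit _ c1 c2 => preserves r c1 && preserves r c2
  | For i _ c => (i != r) && preserves r c
  end.

(** [run] reads a loop bound once, whereas the compiled loop compares counter and bound in every
    round. They agree because the body writes to neither. *)
Fixpoint wf_cmd (K : nat) (c : cmd) : bool :=
  match c with
  | Skip | Out _ => true
  | Inc r | Zero r => r <= K
  | Seq c1 c2 => wf_cmd K c1 && wf_cmd K c2
  | For i r c => [&& i <= K, r <= K, i != r, preserves i c, preserves r c & wf_cmd K c]
  | IfBit r c1 c2 => [&& r <= K, wf_cmd K c1 & wf_cmd K c2]
  end.

Lemma preservesP x r c s : preserves r c -> (run x c s).1 r = s.1 r.
Proof.
elim: c s => [|r'|r'|b|c1 IH1 c2 IH2|i r' c IH|r' c1 IH1 c2 IH2] s //=.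
- by rewrite /= eq_sym => /negbTE ->.
- by rewrite /= eq_sym => /negbTE ->.
- by move=> /andP[h1 h2]; rewrite IH2 // IH1.
- move=> /andP[]; rewrite eq_sym => /negbTE hi hc; rewrite hi.
  by elim: (s.1 r') => [|n IHn] /=; rewrite hi // IH.
- by move=> /andP[h1 h2]; case: ifP => _; [apply: IH1|apply: IH2].
Qed.

Definition height (s : state) (h : nat) := (forall r, s.1 r <= h) /\ size s.2 <= h.

Lemma heightW s h h' : h <= h' -> height s h -> height s h'.
Proof. by move=> le [hr ho]; split=> [r|]; apply: leq_trans le. Qed.

Lemma height_set s r v h : v <= h -> height s h -> height (setr s r v) h.
Proof. by move=> le [hr ho]; split=> // r' /=; case: ifP. Qed.

Lemma height_inc s r h : height s h -> height (incr r s) h.+1.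
Proof.
move=> hs; apply: height_set; last exact: heightW hs.
by rewrite ltnS; case: hs.
Qed.

(** One unit of cost lengthens a register or the output by at most one. The cost therefore also
    bounds how far the head must walk. *)
Lemma height_run x c s h : height s h -> height (run x c s) (h + cost x c s).
Proof.
elim: c s h => [|r'|r'|b|c1 IH1 c2 IH2|i r' c IH|r' c1 IH1 c2 IH2] s h hs /=.
- by rewrite addn0.
- by rewrite addn1; apply: height_inc.
- by apply: height_set => //; apply: heightW hs; apply: leq_addr.
- case: hs => hr ho; split=> [r /=|]; first by apply: leq_trans (hr r) (leq_addr _ _).
  by rewrite size_cat leq_add.
- by rewrite addnA; apply/IH2/IH1.
- apply: height_set => //; rewrite addnA; apply: heightW (leq_addr _ _) _.
  rewrite -/(loop_state x i c s (s.1 r')).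
  elim: (s.1 r') => [|n IHn].
    by rewrite big_ord0 addn0; apply: height_set.
  rewrite big_ord_recr /= addnA addn2 !addnS.
  by apply: heightW (leqnSn _) _; apply: height_inc; apply: IH.
- case: ifP => _; rewrite addnA; apply: heightW (leq_addr _ _) _; [exact: IH1|exact: IH2].
Qed.

(** * The Turing machine that executes a compiled program *)

Section Machine.
Variable K : nat.

(* marker of the leftmost cell, the registers whose value exceeds the position of the cell, input bit, output bit *)
Definition cell := (bool * {ffun 'I_K.+1 -> bool} * option bool * option bool)%type.

Definition cblank : cell := (false, [ffun=> false], None, None).
(* Register 0 starts with the length of the input. *)
Definition cin (b : bool) : cell := (false, [ffun r => r == ord0], Some b, None).
Definition marker (c : cell) : bool := c.1.1.1.
Definition flag (c : cell) (r : nat) : bool := c.1.1.2 (inord r).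
Definition inp (c : cell) : option bool := c.1.2.
Definition outp (c : cell) : option bool := c.2.

Definition setflag (r : nat) (v : bool) (c : cell) : cell :=
  (marker c, [ffun r' : 'I_K.+1 => if val r' == r then v else c.1.1.2 r'], inp c, outp c).
Definition setout (b : bool) (c : cell) : cell := (c.1, Some b).
Definition setmark (c : cell) : cell := (true, c.1.1.2, inp c, outp c).

(* Walk right, rewriting by [i_upd], to the first cell satisfying [i_stop];
   rewrite it by [i_fin], jump to [i_next] of its former content, and return to the leftmost cell. *)
Record instr := Instr {
  i_stop : cell -> bool; i_upd : cell -> cell; i_fin : cell -> cell; i_next : cell -> nat }.

Definition noop (pc : nat) := Instr xpredT id id (fun=> pc).
Definition inc_instr r pc := Instr (fun c => ~~ flag c r) id (setflag r true) (fun=> pc).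
Definition zero_instr r pc := Instr (fun c => ~~ flag c r) (setflag r false) id (fun=> pc).
Definition out_instr b pc := Instr (fun c => ~~ outp c) id (setout b) (fun=> pc).
(** The walk ends at the cell whose position is the value of [i]; the track of [r] shows there
    whether this position is below the value of [r]. No second walk is needed to compare. *)
Definition less_instr i r pc1 pc2 :=
  Instr (fun c => ~~ flag c i) id id (fun c => if flag c r then pc1 else pc2).
Definition bit_instr r pc1 pc2 :=
  Instr (fun c => ~~ flag c r) id id (fun c => if inp c == Some true then pc1 else pc2).

Fixpoint len (c : cmd) : nat :=
  match c with
  | Skip => 0
  | Inc _ | Zero _ | Out _ => 1
  | Seq c1 c2 => len c1 + len c2
  | For i r c => (len c).+4
  | IfBit r c1 c2 => (len c1 + len c2).+2
  end.

Fixpoint compile (a : nat) (c : cmd) : seq instr :=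
  match c with
  | Skip => [::]
  | Inc r => [:: inc_instr r a.+1]
  | Zero r => [:: zero_instr r a.+1]
  | Out b => [:: out_instr b a.+1]
  | Seq c1 c2 => compile a c1 ++ compile (a + len c1) c2
  | For i r c => [:: zero_instr i a.+1, less_instr i r a.+2 (a.+3 + len c) &
      compile a.+2 c ++ [:: inc_instr i a.+1; zero_instr i (a.+4 + len c)]]
  | IfBit r c1 c2 => bit_instr r a.+1 (a.+2 + len c1) ::
      compile a.+1 c1 ++ noop (a.+2 + len c1 + len c2) :: compile (a.+2 + len c1) c2
  end.

Lemma size_compile a c : size (compile a c) = len c.
Proof.
by elim: c a => //= [c1 IH1 c2 IH2|i r c IH|r c1 IH1 c2 IH2] a;
  rewrite size_cat /= ?IH1 ?IH2 ?IH; lia.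
Qed.

Variable code : seq instr.
Let L := size code.

(** [None] is the start state, which only marks the leftmost cell. The Boolean is true on the way
    back, when the index is already that of the next instruction. *)
Definition mstate := option (bool * 'I_L.+1).

Definition mdelta (q : mstate) (c : cell) : mstate * cell * move :=
  match q with
  | None => (Some (false, ord0), setmark c, MoveS)
  | Some (false, pc) =>
      let ins := nth (noop 0) code pc in
      if i_stop ins c then (Some (true, inord (i_next ins c)), i_fin ins c, MoveS)
      else (q, i_upd ins c, MoveR)
  | Some (true, pc) => if marker c then (Some (false, pc), c, MoveS) else (q, c, MoveL)
  end.

Definition mhalt (q : mstate) : bool :=
  if q is Some (false, pc) then val pc == L else false.

Definition machine : TM :=
  {| tm_state := mstate; tm_sym := cell; tm_blank := cblank; tm_in := cin;
     tm_out := outp; tm_out_blank := erefl; tm_start := None;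
     tm_halt := mhalt; tm_delta := mdelta |}.

Variable x : seq bool.

Definition cell_at (s : state) (i : nat) : cell :=
  (i == 0, [ffun r : 'I_K.+1 => i < s.1 r], onth x i, onth s.2 i).

(** The tape list may or may not contain trailing blanks, so its right part is compared only through
    [nth] with the blank as default. *)
Definition config_at (pc : nat) (s : state) (cf : config machine) : Prop :=
  exists2 r, cf = (Some (false, inord pc), [::], cell_at s 0, r)
           & forall i, nth cblank r i = cell_at s i.+1.

Variant goes (pc : nat) (s : state) (pc' : nat) (s' : state) (T : nat) : Prop :=
  Goes of forall cf, config_at pc s cf ->
    exists2 n, n <= T & config_at pc' s' (iter n (@tm_step machine) cf).

Lemma goes_refl pc s T : goes pc s pc s T.
Proof. by split=> cf h; exists 0. Qed.

Lemma goes_trans pc2 s2 pc1 s1 pc3 s3 T1 T2 :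
  goes pc1 s1 pc2 s2 T1 -> goes pc2 s2 pc3 s3 T2 -> goes pc1 s1 pc3 s3 (T1 + T2).
Proof.
move=> [h1] [h2]; split=> cf /h1[n1 le1 /h2[n2 le2 h]].
by exists (n2 + n1); rewrite ?iterD // addnC leq_add.
Qed.

Lemma goes_le pc s pc' s' T T' : T <= T' -> goes pc s pc' s' T -> goes pc s pc' s' T'.
Proof. by move=> le [h]; split=> cf /h[n len h']; exists n => //; apply: leq_trans le. Qed.

Lemma behead_tape (r : seq cell) (f : nat -> cell) j :
  (forall i, nth cblank r i = f (j.+1 + i)) ->
  forall i, nth cblank (behead r) i = f (j.+2 + i).
Proof. by move=> hr i; rewrite nth_behead hr; congr f; lia. Qed.

(** The [2 * h + 2] steps are [h] moves right, one rewriting of the stopping cell, [h] moves left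
    and one turn at the marker. *)
Lemma goes_instr pc h s s' (ins := nth (noop 0) code pc) :
    pc < L ->
    (forall j, j < h -> ~~ i_stop ins (cell_at s j)) ->
    i_stop ins (cell_at s h) ->
    (forall j, j < h -> cell_at s' j = i_upd ins (cell_at s j)) ->
    cell_at s' h = i_fin ins (cell_at s h) ->
    (forall j, h < j -> cell_at s' j = cell_at s j) ->
  goes pc s (i_next ins (cell_at s h)) s' (2 * h + 2).
Proof.
move=> ltpc hnstop hstop hupd hfin hrest; split=> cf [r0 -> hr0].
set pc' := i_next _ _.
have scan j : j <= h -> exists2 r,
    iter j (@tm_step machine) (Some (false, inord pc), [::], cell_at s 0, r0)
      = (Some (false, inord pc), rev (mkseq (cell_at s') j), cell_at s j, r)
    & forall i, nth cblank r i = cell_at s (j.+1 + i).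
  elim: j => [_|j IH ltj]; first by exists r0 => //= i; rewrite hr0.
  have [r /= -> hr] := IH (ltnW ltj); exists (behead r); last exact: behead_tape.
  rewrite /= inordK ?ltnS 1?ltnW // ltn_eqF // -/ins (negbTE (hnstop _ ltj)).
  rewrite mkseqS rev_rcons -hupd //.
  by case: r hr => [|b r'] /= hr; have := hr 0; rewrite addn0 /= => ->.
have back j r : j <= h -> (forall i, nth cblank r i = cell_at s' (j.+1 + i)) ->
  exists2 r', iter j (@tm_step machine)
      (Some (true, inord pc'), rev (mkseq (cell_at s') j), cell_at s' j, r)
      = (Some (true, inord pc'), [::], cell_at s' 0, r')
    & forall i, nth cblank r' i = cell_at s' (1 + i).
  elim: j r => [|j IH] r lej hr; first by exists r.
  rewrite iterSr /= mkseqS rev_rcons /=.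
  by apply: IH => [|[|i]] /=; rewrite ?addn0 ?hr 1?ltnW // addSnnS.
have [r1 e1 hr1] := scan h (leqnn h).
have hr1' i : nth cblank r1 i = cell_at s' (h.+1 + i) by rewrite hr1 hrest // ltnS leq_addr.
have [r2 e2 hr2] := back h r1 (leqnn h) hr1'.
exists (1 + (h + (1 + h))); first lia.
exists r2 => //.
rewrite iterD (iterD h) (iterD 1 h) e1.
rewrite [iter 1 _ (_, _, cell_at s h, _)]/= inordK ?ltnS 1?ltnW // ltn_eqF // -/ins hstop -hfin.
by rewrite -/pc' e2.
Qed.

Definition code_at (a : nat) (l : seq instr) : Prop :=
  exists pre post, code = pre ++ l ++ post /\ size pre = a.

Lemma code_at_cat a l1 l2 :
  code_at a (l1 ++ l2) -> code_at a l1 /\ code_at (a + size l1) l2.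
Proof.
move=> [pre [post [e <-]]]; split; first by exists pre, (l2 ++ post); rewrite e -!catA.
by exists (pre ++ l1), post; rewrite size_cat e -!catA.
Qed.

Lemma code_at_cons a i l : code_at a (i :: l) ->
  [/\ a < L, nth (noop 0) code a = i & code_at a.+1 l].
Proof.
rewrite -cat1s => /code_at_cat[[pre [post [e <-]]] h2]; split; last by rewrite -addn1.
  by rewrite /L e !size_cat /=; lia.
by rewrite e nth_cat ltnn subnn.
Qed.

Lemma cell_at_flag s j r : r <= K -> flag (cell_at s j) r = (j < s.1 r).
Proof. by move=> le; rewrite /flag ffunE inordK. Qed.

Lemma goes_inc a r s pc : r <= K -> a < L -> nth (noop 0) code a = inc_instr r pc ->
  goes a s pc (incr r s) (2 * s.1 r + 2).
Proof.
move=> le lta e; have := @goes_instr a (s.1 r) s (incr r s) lta.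
rewrite e /=; apply => [j ltj||j ltj||j ltj].
- by rewrite cell_at_flag // ltj.
- by rewrite cell_at_flag // ltnn.
- rewrite /cell_at /= /setflag /=; congr (_, _, _, _); apply/ffunP => r'; rewrite !ffunE.
  by case: eqP => [->|//]; rewrite ltj ltnS ltnW.
- rewrite /cell_at /= /setflag /=; congr (_, _, _, _); apply/ffunP => r'; rewrite !ffunE /=.
  by case: eqP => [_|//]; rewrite ltnSn.
- rewrite /cell_at /=; congr (_, _, _, _); apply/ffunP => r'; rewrite !ffunE /=.
  by case: eqP => [->|//]; lia.
Qed.

Lemma goes_zero a r s pc : r <= K -> a < L -> nth (noop 0) code a = zero_instr r pc ->
  goes a s pc (setr s r 0) (2 * s.1 r + 2).
Proof.
move=> le lta e; have := @goes_instr a (s.1 r) s (setr s r 0) lta.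
rewrite e /=; apply => [j ltj||j ltj||j ltj].
- by rewrite cell_at_flag // ltj.
- by rewrite cell_at_flag // ltnn.
- by rewrite /cell_at /= /setflag /=; congr (_, _, _, _); apply/ffunP => r'; rewrite !ffunE;
    case: eqP.
- rewrite /cell_at /=; congr (_, _, _, _); apply/ffunP => r'; rewrite !ffunE /=.
  by case: eqP => [->|//]; rewrite ltnn.
- rewrite /cell_at /=; congr (_, _, _, _); apply/ffunP => r'; rewrite !ffunE /=.
  by case: eqP => [->|//]; lia.
Qed.

Lemma goes_out a b s pc : a < L -> nth (noop 0) code a = out_instr b pc ->
  goes a s pc (appo s [:: b]) (2 * size s.2 + 2).
Proof.
move=> lta e; have := @goes_instr a (size s.2) s (appo s [:: b]) lta.
rewrite e /=; apply => [j ltj||j ltj||j ltj]; rewrite /cell_at /outp /setout /=.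
- by rewrite onthE (nth_map false).
- by rewrite onth_default.
- by rewrite onth_cat ltj.
- by rewrite onth_cat ltnn subnn.
- by congr (_, _); rewrite onth_cat ltnNge (ltnW ltj) /= !onth_default //=; lia.
Qed.

Lemma goes_test a i s nxt : i <= K -> a < L ->
  nth (noop 0) code a = Instr (fun c => ~~ flag c i) id id nxt ->
  goes a s (nxt (cell_at s (s.1 i))) s (2 * s.1 i + 2).
Proof.
move=> le lta e; have := @goes_instr a (s.1 i) s s lta.
rewrite e /=; apply => // [j ltj|].
- by rewrite cell_at_flag // ltj.
- by rewrite cell_at_flag // ltnn.
Qed.

Lemma goes_noop a pc s : a < L -> nth (noop 0) code a = noop pc -> goes a s pc s 2.
Proof. by move=> lta e; have := @goes_instr a 0 s s lta; rewrite e /=; apply. Qed.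

(* A command of cost [k] started below height [h] stays below [h + k], so each instruction takes [O(h + k)] steps. *)
Lemma goes_cmd c a s h : wf_cmd K c -> code_at a (compile a c) -> height s h ->
  goes a s (a + len c) (run x c s) (cost x c s * (2 * (h + cost x c s) + 2)).
Proof.
elim: c a s h => [|r|r|b|c1 IH1 c2 IH2|i r c IH|r c1 IH1 c2 IH2] a s h /=.
- by move=> *; rewrite addn0; apply: goes_refl.
- move=> le /code_at_cons[lta e _] [hr _]; rewrite addn1.
  by apply: goes_le (goes_inc _ le lta e) => //; have := hr r; lia.
- move=> le /code_at_cons[lta e _] [hr _]; rewrite addn1.
  by apply: goes_le (goes_zero _ le lta e) => //; have := hr r; lia.
- move=> le /code_at_cons[lta e _] [_ ho]; rewrite addn1.
  by apply: goes_le (goes_out _ lta e) => //; lia.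
- move=> /andP[w1 w2] /code_at_cat[k1 k2] hs; rewrite addnA.
  rewrite size_compile in k2.
  apply: goes_le (goes_trans (IH1 _ _ _ w1 k1 hs) (IH2 _ _ _ w2 k2 (height_run x c1 hs))).
  by nia.
- move=> /and5P[lei ler neir prei /andP[prer wc]].
  move=> /code_at_cons[l0 e0] /code_at_cons[l1 e1] /code_at_cat[kc].
  rewrite size_compile => /code_at_cons[l2 e2] /code_at_cons[l3 e3 _] hs.
  (* [B] bounds every single walk of the loop, because no height exceeds [h] plus the total cost
     [S + 3]. Below, [C n] is the cost of the first [n] rounds. *)
  set S := \sum_(j < _) _; set B := 2 * (h + (S + 3)) + 2.
  rewrite -/(loop_state x i c s (s.1 r)).
  pose C n := \sum_(j < n) (cost x c (loop_state x i c s j) + 2).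
  have Cmono n : n <= s.1 r -> C n <= S.
    move=> le; rewrite /S -(subnKC le) big_split_ord /=; exact: leq_addr.
  have sti n : (loop_state x i c s n).1 i = n.
    elim: n => [|n IHn]; rewrite /loop_state /= eqxx //.
    by rewrite preservesP // -/(loop_state x i c s n) IHn.
  have str n : (loop_state x i c s n).1 r = s.1 r.
    elim: n => [|n IHn]; rewrite /loop_state /= eq_sym (negbTE neir) //.
    by rewrite preservesP // -/(loop_state x i c s n) IHn.
  have hst n : height (loop_state x i c s n) (h + C n).
    elim: n => [|n IHn]; first by rewrite /C big_ord0 addn0; apply: height_set.
    rewrite /C big_ord_recr /= addnA addn2 !addnS -/(C n).
    by apply: heightW (leqnSn _) _; apply: height_inc; apply: height_run.
  have bnd n m : n <= s.1 r -> m <= C n + h -> 2 * m + 2 <= B.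
    by move=> /Cmono le lm; rewrite /B; lia.
  have loop n : n <= s.1 r ->
      goes a.+1 (setr s i 0) a.+1 (loop_state x i c s n) (C n * B).
    elim: n => [|n IHn] ltn; first exact: goes_refl.
    apply: (@goes_le _ _ _ _ (C n * B + (B + (cost x c (loop_state x i c s n) * B + B)))).
      by rewrite [C n.+1]/C big_ord_recr /= -/(C n); nia.
    apply: goes_trans (IHn (ltnW ltn)) _.
    apply: (@goes_trans a.+2 (loop_state x i c s n)).
      have := goes_test (loop_state x i c s n) lei l1 e1.
      rewrite cell_at_flag // sti str ltn.
      by apply: goes_le; apply: (bnd n); [lia|have := (hst n).1 i; rewrite sti; lia].
    apply: goes_trans (goes_le _ (IH _ _ _ wc kc (hst n))) _.
      rewrite leq_mul2l; apply/orP; right.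
      apply: (bnd n.+1 _ ltn); rewrite /C big_ord_recr /= -/(C n); lia.
    apply: goes_le (goes_inc _ lei l2 e2).
    apply: (bnd n.+1 _ ltn); rewrite preservesP //; have := (hst n).1 i.
    by rewrite sti /C big_ord_recr /= -/(C n); lia.
  (* In order: the first reset, all rounds, then the failing test and the last reset. *)
  have -> : (S + 3) * B = B + (S * B + (B + B)) by lia.
  apply: goes_trans (goes_le _ (goes_zero _ lei l0 e0)) _.
    by apply: (bnd 0) => //; have := hs.1 i; lia.
  apply: goes_trans (loop _ (leqnn _)) _.
  apply: (@goes_trans (a.+3 + len c) (loop_state x i c s (s.1 r))).
    have := goes_test (loop_state x i c s (s.1 r)) lei l1 e1.
    rewrite cell_at_flag // sti str ltnn.
    by apply: goes_le; apply: (bnd (s.1 r)) => //; have := (hst (s.1 r)).1 i; rewrite sti; lia.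
  have -> : a + (len c).+4 = a.+4 + len c by lia.
  apply: goes_le (goes_zero _ lei l3 e3).
  by apply: (bnd (s.1 r)) => //; have := (hst (s.1 r)).1 i; rewrite sti; lia.
- move=> /and3P[ler w1 w2] /code_at_cons[l0 e0] /code_at_cat[k1].
  rewrite size_compile => /code_at_cons[l1 e1 k2] hs.
  have := goes_test s ler l0 e0; rewrite /inp /=.
  have -> : (onth x (s.1 r) == Some true) = nth false x (s.1 r).
    rewrite onthE; case: (ltnP (s.1 r) (size x)) => lt.
      by rewrite (nth_map false) //; case: nth.
    by rewrite !nth_default ?size_map.
  have hr := hs.1 r.
  case: ifP => _ g0.
    apply: goes_le (goes_trans g0 (goes_trans (IH1 _ _ _ w1 k1 hs) _)); last first.
      have -> : a + (len c1 + len c2).+2 = a.+2 + len c1 + len c2 by lia.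
      exact: goes_noop _ l1 e1.
    by nia.
  have -> : a + (len c1 + len c2).+2 = a.+2 + len c1 + len c2 by lia.
  by apply: goes_le (goes_trans g0 (IH2 _ _ _ w2 k2 hs)); nia.
Qed.

End Machine.

Definition init_state (x : seq bool) : state := (fun r => if r == 0 then size x else 0, [::]).

Lemma read_bits_onth (M : TM) ds s :
  (forall i, @tm_out M (nth (@tm_blank M) ds i) = onth s i) -> read_bits ds = s.
Proof.
elim: ds s => [|a ds IH] [|b s] h //=.
- by have := h 0; rewrite /= tm_out_blank.
- by have := h 0; rewrite /= => ->.
- by have := h 0; rewrite /= => ->; congr cons; apply: IH => i; apply: (h i.+1).
Qed.

Lemma config_init K (code : seq (instr K)) x :
  config_at x 0 (init_state x) (@tm_step (machine code) (tm_init (machine code) x)).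
Proof.
have e0 : ord0 = inord 0 :> 'I_(size code).+1 by apply/val_inj; rewrite /= inordK.
case: x => [|b x] /=.
  exists [::].
    rewrite e0; congr (_, _, _, _); rewrite /setmark /cell_at /=; congr (_, _, _, _).
    by apply/ffunP => r; rewrite !ffunE /=; case: ifP.
  move=> i; rewrite nth_nil /cell_at /= /cblank; congr (_, _, _, _).
  by apply/ffunP => r; rewrite !ffunE /=; case: ifP.
exists (map (@cin K) x).
  rewrite e0; congr (_, _, _, _); rewrite /setmark /cell_at /=; congr (_, _, _, _).
  by apply/ffunP => r; rewrite !ffunE /= -val_eqE /=; case: ifP.
move=> i; rewrite /cell_at /=; case: (ltnP i (size x)) => lt.
  rewrite (nth_map false) // onthE (nth_map false) // /cin; congr (_, _, _, _).
  by apply/ffunP => r; rewrite !ffunE -val_eqE /=; case: ifP.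
rewrite nth_default ?size_map // onth_default // /cblank; congr (_, _, _, _).
by apply/ffunP => r; rewrite !ffunE /=; case: ifP => // _; rewrite ltnS ltnNge lt.
Qed.

(** The time is the number of instructions times the longest walk; the final [+ 1] is the step that
    marks the leftmost cell. *)
Lemma machine_computes K c (g : seq bool -> seq bool) (T : nat -> nat) :
    wf_cmd K c ->
    (forall x, (run x c (init_state x)).2 = g x) ->
    (forall x, cost x c (init_state x) <= T (size x)) ->
  computes_in (machine (compile K 0 c)) g
    (fun n => T n * (2 * (n + T n) + 2) + 1).
Proof.
move=> wc hg hT x; set code := compile K 0 c.
have hs : height (init_state x) (size x) by split=> //= r; case: ifP.
have k0 : code_at code 0 (compile K 0 c) by exists [::], [::]; rewrite cats0.
have [/(_ _ (config_init code x))[n len [r e hr]]] := goes_cmd x wc k0 hs.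
exists n.+1; rewrite iterSr; split; first by have := hT x; nia.
move: e; set cf := iter n _ _ => ->; rewrite -hg; split.
  by rewrite /= inordK ?size_compile // eqxx.
by apply: (@read_bits_onth (machine code) (cell_at K x _ 0 :: r)) => -[|i] //=; rewrite hr.
Qed.

(** * Cost of loop programs and printing of facts *)

Lemma expn_monol e m n : m <= n -> m ^ e <= n ^ e.
Proof. by case: e => // e le; rewrite leq_exp2r. Qed.

Definition poly_bounded (f : seq bool -> nat) : Prop :=
  exists k, forall x, f x <= (size x + 2) ^ k.

Lemma poly_bounded_le g f : (forall x, f x <= g x) -> poly_bounded g -> poly_bounded f.
Proof. by move=> le [k hk]; exists k => x; apply: leq_trans (le x) (hk x). Qed.

Lemma poly_bounded_const c : poly_bounded (fun=> c).
Proof.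
exists c => x; apply: leq_trans (ltnW (ltn_expl c (ltnSn 1))) _.
by apply: expn_monol; rewrite leq_addl.
Qed.

Lemma poly_bounded_size : poly_bounded size.
Proof. by exists 1 => x; rewrite expn1 leq_addr. Qed.

Lemma poly_bounded_mul f g : poly_bounded f -> poly_bounded g ->
  poly_bounded (fun x => f x * g x).
Proof. by move=> [a ha] [b hb]; exists (a + b) => x; rewrite expnD leq_mul. Qed.

Lemma poly_bounded_add f g : poly_bounded f -> poly_bounded g ->
  poly_bounded (fun x => f x + g x).
Proof.
move=> [a ha] [b hb]; exists (a + b).+1 => x.
have le c d : (size x + 2) ^ c <= (size x + 2) ^ (c + d).
  by rewrite leq_pexp2l ?leq_addr // addn2.
have := leq_trans (ha x) (le a b); have := leq_trans (hb x) (le b a).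
rewrite (addnC b) expnS; nia.
Qed.

Lemma poly_bounded_exp f k : poly_bounded f -> poly_bounded (fun x => f x ^ k).
Proof. by move=> [a ha]; exists (a * k) => x; rewrite expnM expn_monol. Qed.

Lemma poly_bounded_time f : poly_bounded f ->
  exists k, forall x, f x <= size x ^ k + k.
Proof.
move=> [k hk]; exists (2 * k + 3 ^ k) => x; apply: leq_trans (hk x) _.
case: (ltnP (size x) 2) => lt.
  apply: (@leq_trans (3 ^ k)); first by apply: expn_monol; lia.
  by rewrite addnA leq_addl.
apply: leq_trans (leq_addr _ _); apply: (@leq_trans (size x ^ (2 * k))).
  by rewrite expnM expn_monol // -mulnn; nia.
by rewrite leq_pexp2l ?leq_addr // ltnW.
Qed.

(* The only register that may grow is [d], and [d] bounds no loop. *)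
Fixpoint static (d : nat) (c : cmd) : bool :=
  match c with
  | Skip | Out _ | Zero _ => true
  | Inc r => r == d
  | Seq c1 c2 | IfBit _ c1 c2 => static d c1 && static d c2
  | For i r c => (r != d) && static d c
  end.

(** Registers other than [d] never rise above [B]: a counter stops at its bound, which is such a
    register, and [Inc] touches only [d]. Each loop makes at most [B] rounds, and the exponent
    depends on the command alone. *)
Lemma static_cost K d c : wf_cmd K c -> static d c ->
  exists k, forall x s B, (forall r, r != d -> s.1 r <= B) ->
    cost x c s <= (B + 2) ^ k /\ forall r, r != d -> (run x c s).1 r <= B.
Proof.
elim: c => [|r|r|b|c1 IH1 c2 IH2|i r c IH|r c1 IH1 c2 IH2] /=.
- by exists 0.
- move=> _ /eqP ->; exists 0 => x s B h; split=> // r' nd /=; rewrite (negbTE nd); exact: h.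
- by exists 0 => x s B h; split=> // r' /h; case: ifP.
- by exists 0.
- move=> /andP[w1 w2] /andP[s1 s2]; have [k1 h1] := IH1 w1 s1; have [k2 h2] := IH2 w2 s2.
  exists (k1 + k2).+1 => x s B h.
  have [g1 h'] := h1 x s B h; have [g2 h''] := h2 x _ B h'; split=> //.
  have e1 : 0 < (B + 2) ^ k1 by rewrite expn_gt0 addn2.
  have e2 : 0 < (B + 2) ^ k2 by rewrite expn_gt0 addn2.
  by rewrite expnS expnD; nia.
- move=> /and5P[_ _ _ prei /andP[_ w]] /andP[neq st]; have [k hk] := IH w st.
  exists (k.+3) => x s B h.
  have hst n : n <= s.1 r -> forall r', r' != d -> (loop_state x i c s n).1 r' <= B.
    elim: n => [|n IHn] ltn r' nd; first by rewrite /=; case: ifP => // _; apply: h.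
    have [_ hr] := hk x _ B (IHn (ltnW ltn)).
    rewrite /=; case: ifP => [_|_]; last exact: hr.
    apply: leq_trans (h _ neq); rewrite preservesP //; apply: leq_ltn_trans ltn.
    by elim: (n) => [|m IHm] /=; rewrite eqxx // preservesP.
  split; last first.
    by move=> r' nd /=; case: ifP => // _; apply: hst.
  apply: (@leq_trans (\sum_(j < s.1 r) ((B + 2) ^ k + 2) + 3)).
    rewrite leq_add2r; apply: leq_sum => j _; rewrite leq_add2r.
    by have [] := hk x _ B (hst j (ltnW (ltn_ord j))).
  rewrite sum_nat_const card_ord.
  have := h _ neq; have : 0 < (B + 2) ^ k by rewrite expn_gt0 addn2.
  rewrite !expnS; set E := _ ^ k; set n := s.1 r => E0 le.
  apply: (@leq_trans (B * (E + 2) + 3)); first by rewrite leq_add2r leq_mul2r le orbT.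
  have le1 : B <= B * E by rewrite leq_pmulr.
  have -> : (B + 2) * ((B + 2) * ((B + 2) * E)) =
    B * B * B * E + 6 * (B * B * E) + 12 * (B * E) + 8 * E by lia.
  lia.
- move=> /and3P[_ w1 w2] /andP[s1 s2]; have [k1 h1] := IH1 w1 s1; have [k2 h2] := IH2 w2 s2.
  exists (k1 + k2).+2 => x s B h.
  have [g1 h'] := h1 x s B h; have [g2 h''] := h2 x _ B h.
  have e1 : 0 < (B + 2) ^ k1 by rewrite expn_gt0 addn2.
  have e2 : 0 < (B + 2) ^ k2 by rewrite expn_gt0 addn2.
  have g : (B + 2) ^ k1 + 2 <= (B + 2) ^ (k1 + k2).+2 /\ (B + 2) ^ k2 + 1 <= (B + 2) ^ (k1 + k2).+2.
    by rewrite !expnS expnD; split; nia.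
  by case: ifP => _; split=> //; lia.
Qed.

(** The whole program is not [static], since the registers it computes bound later loops. It is cut
    into stages with exactly known states: each stage is static for one register, and its initial
    registers are polynomial in the input size. *)
Definition polyrun (K : nat) (c : cmd) (I O : seq bool -> state) : Prop :=
  [/\ wf_cmd K c, forall x, run x c (I x) = O x & poly_bounded (fun x => cost x c (I x))].

Lemma polyrun_seq Q K c1 c2 I O :
  polyrun K c1 I Q -> polyrun K c2 Q O -> polyrun K (Seq c1 c2) I O.
Proof.
move=> [w1 r1 k1] [w2 r2 k2]; split=> [|x|] /=; first by rewrite w1.
  by rewrite r1.
by apply: poly_bounded_le (poly_bounded_add k1 k2) => x; rewrite r1.
Qed.

Definition mkstate (v : seq nat) (out : seq bool) : state := (nth 0 v, out).

Lemma setr_mkstate v out r n : setr (mkstate v out) r n = mkstate (set_nth 0 v r n) out.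
Proof. by congr (_, _); apply: functional_extensionality => i; rewrite nth_set_nth. Qed.

Lemma nth_le_sumn v r : nth 0 v r <= sumn v.
Proof.
elim: v r => [|a v IH] [|r] //=; first exact: leq_addr.
exact: leq_trans (IH r) (leq_addl _ _).
Qed.

Lemma polyrun_static K d c (v : seq bool -> seq nat) out O :
    wf_cmd K c -> static d c -> poly_bounded (fun x => sumn (v x)) ->
    (forall x, run x c (mkstate (v x) (out x)) = O x) ->
  polyrun K c (fun x => mkstate (v x) (out x)) O.
Proof.
move=> w st pv hr; split=> //; have [k hk] := static_cost w st.
apply: poly_bounded_le (poly_bounded_exp k (poly_bounded_add pv (poly_bounded_const 2))) => x.
by have [] := hk x (mkstate (v x) (out x)) (sumn (v x)) (fun r _ => nth_le_sumn (v x) r).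
Qed.

(** Arguments of printed facts are sums of registers, with repetition, plus a constant. Such a sum
    is printed in unary by consecutive loops, without computing it in a register. *)
Notation expr := (seq nat * nat)%type.
Notation ftemplate := (nat * seq expr)%type.

Section Runs.
Variable x : seq bool.

Lemma run_for (S : nat -> state) i r c s :
    S 0 = setr s i 0 -> (forall j, j < s.1 r -> incr i (run x c (S j)) = S j.+1) ->
  run x (For i r c) s = setr (S (s.1 r)) i 0.
Proof.
move=> h0 hS /=; congr (setr _ _ _).
have: forall n, n <= s.1 r -> loop_state x i c s n = S n; last by apply.
elim=> [|n IH] ltn; first by rewrite h0.
by rewrite /loop_state /= -/(loop_state x i c s n) IH ?hS // ltnW.
Qed.

Lemma setr_id s i v : s.1 i = v -> setr s i v = s.
Proof.
case: s => f o /= <-; congr (_, _); apply: functional_extensionality => r /=.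
by case: eqP => [->|].
Qed.

Lemma setr_set s i v w : setr (setr s i v) i w = setr s i w.
Proof. by congr (_, _); apply: functional_extensionality => r /=; case: eqP. Qed.

Lemma setrC s i j v w : i != j -> setr (setr s i v) j w = setr (setr s j w) i v.
Proof.
move=> /eqP ne; congr (_, _); apply: functional_extensionality => r /=.
by do 2!case: eqP => //; congruence.
Qed.

(** The counter is zero before and after the loop, so all registers are restored and the loop acts
    as pure output. Printing loops can then be nested and chained. *)
Lemma run_for_out (g : nat -> seq bool) i r c s : s.1 i = 0 ->
    (forall j o, j < s.1 r -> run x c ((setr s i j).1, o) = ((setr s i j).1, o ++ g j)) ->
  run x (For i r c) s = appo s (flatten [seq g j | j <- iota 0 (s.1 r)]).
Proof.
move=> si hg.
rewrite (@run_for (fun j => appo (setr s i j) (flatten [seq g j | j <- iota 0 j]))).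
- by rewrite -[LHS]/(appo (setr (setr s i (s.1 r)) i 0) _) setr_set setr_id.
- by rewrite /appo /= cats0.
move=> j ltj; rewrite [run x c _]hg // -addn1 iotaD map_cat flatten_cat /= cats0.
congr (_, _); last by rewrite /= catA.
by apply: functional_extensionality => r' /=; rewrite eqxx addn1; case: eqP.
Qed.

Lemma run_for_add k d i r c s : s.1 i = 0 -> i != d ->
    (forall j v, j < s.1 r ->
       run x c (setr (setr s i j) d v) = setr (setr s i j) d (v + k)) ->
  run x (For i r c) s = setr s d (s.1 d + k * s.1 r).
Proof.
move=> si ne hc.
rewrite (@run_for (fun j => setr (setr s i j) d (s.1 d + k * j))).
- by rewrite (setrC _ _ _ ne) setr_set setr_id //= (negbTE ne).
- by rewrite muln0 addn0 (setr_id si) setr_id.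
move=> j ltj; rewrite hc // /incr /= (negbTE ne) eqxx (setrC _ _ _ ne) setr_set -setrC //.
by rewrite -addnA mulnS (addnC k).
Qed.

Definition seqs (cs : seq cmd) : cmd := foldr Seq Skip cs.

Definition add_const (d k : nat) : cmd := seqs (nseq k (Inc d)).

Lemma run_add_const d k s : run x (add_const d k) s = setr s d (s.1 d + k).
Proof.
elim: k s => [|k IH] s /=; first by rewrite addn0 setr_id.
by rewrite IH /incr setr_set /= eqxx addSnnS.
Qed.

Fixpoint add_power (b k r d : nat) : cmd :=
  if k is k'.+1 then For (b + k') r (add_power b k' r d) else Inc d.

Lemma run_add_power b k r d s : (forall j, b <= j < b + k -> s.1 j = 0) ->
    r < b -> d < b -> r != d ->
  run x (add_power b k r d) s = setr s d (s.1 d + s.1 r ^ k).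
Proof.
move=> + ltr ltd ne; elim: k s => [|k IH] s hs; first by rewrite expn0 addn1.
rewrite [add_power _ _ _ _]/= expnS mulnC; apply: run_for_add; first by apply: hs; lia.
  by lia.
move=> j v ltj; rewrite IH /=.
- by rewrite eqxx setr_set (negbTE ne) ltn_eqF // ltn_addr.
- by move=> j' ltj'; rewrite !ifN_eq ?hs; lia.
Qed.

Definition eval (s : state) (e : expr) : nat := sumn (map s.1 e.1) + e.2.
Definition feval (s : state) (f : ftemplate) : fact := (f.1, map (eval s) f.2).

Definition outs (bs : seq bool) : cmd := seqs (map Out bs).
Definition out_expr (u : nat) (e : expr) : cmd :=
  Seq (seqs [seq For u r (Out true) | r <- e.1]) (outs (enc_nat e.2)).
Definition out_fact (u : nat) (f : ftemplate) : cmd :=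
  Seq (outs (true :: enc_nat f.1))
   (Seq (seqs [seq Seq (Out true) (out_expr u e) | e <- f.2]) (Out false)).
Definition out_facts (u : nat) (fs : seq ftemplate) : cmd := seqs (map (out_fact u) fs).

(** This is [enc_db] without its end marker, hence additive under concatenation; the program prints
    the marker once, at the very end. *)
Definition enc_facts (D : database) : seq bool := flatten [seq true :: enc_fact f | f <- D].

Lemma appoA s o1 o2 : appo (appo s o1) o2 = appo s (o1 ++ o2).
Proof. by rewrite /appo /= catA. Qed.

Lemma run_outs bs s : run x (outs bs) s = appo s bs.
Proof.
elim: bs s => [|b bs IH] s; first by case: s => f o; rewrite /appo /= cats0.
by rewrite /outs /= -/(outs bs) IH appoA.
Qed.

Lemma run_seqs_out (T : Type) (h : T -> cmd) (g : T -> seq bool) (f : nat -> nat) ts o :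
  (forall t o, run x (h t) (f, o) = (f, o ++ g t)) ->
  run x (seqs (map h ts)) (f, o) = (f, o ++ flatten (map g ts)).
Proof.
by move=> hh; elim: ts o => [|t ts IH] o /=; rewrite ?cats0 // hh IH catA.
Qed.

Lemma run_out_expr u e s : s.1 u = 0 ->
  run x (out_expr u e) s = appo s (enc_nat (eval s e)).
Proof.
case: s e => f o [rs k] /= fu; rewrite run_outs.
rewrite (@run_seqs_out _ _ (fun r => nseq (f r) true)) => [|r o'].
  rewrite /appo /enc_nat /eval /= nseqD -!catA; congr (_, _ ++ _).
  by congr (_ ++ _); elim: rs => //= r rs ->; rewrite nseqD.
rewrite (@run_for_out (fun=> [:: true])) //= /appo /=; congr (_, _ ++ _).
have: forall m, flatten [seq [:: true] | _ <- iota m (f r)] = nseq (f r) true; last by apply.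
by elim: (f r) => //= n IH m; rewrite IH.
Qed.

Lemma run_out_fact u t s : s.1 u = 0 ->
  run x (out_fact u t) s = appo s (true :: enc_fact (feval s t)).
Proof.
case: s t => f o [p es] fu; rewrite [LHS]/= -/(outs _) run_outs /appo /=.
rewrite (@run_seqs_out _ _ (fun e => true :: enc_nat (eval (f, o) e))) => [|e o'].
  by congr (_, _); rewrite /enc_fact /enc_list /= -map_comp /comp -!catA.
by rewrite -[LHS]/(run x (out_expr u e) (appo (f, o') [:: true])) run_out_expr // /appo -catA.
Qed.

Lemma run_out_facts u ts f o : f u = 0 ->
  run x (out_facts u ts) (f, o) = (f, o ++ enc_facts (map (feval (f, [::])) ts)).
Proof.
move=> fu; rewrite /out_facts (@run_seqs_out _ _ (fun t => true :: enc_fact (feval (f, [::]) t))).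
  by rewrite /enc_facts -map_comp.
by move=> t o'; rewrite run_out_fact.
Qed.

End Runs.

Lemma enc_facts_cat D1 D2 : enc_facts (D1 ++ D2) = enc_facts D1 ++ enc_facts D2.
Proof. by rewrite /enc_facts map_cat flatten_cat. Qed.

Lemma enc_facts_flatten Ds : enc_facts (flatten Ds) = flatten (map enc_facts Ds).
Proof. by elim: Ds => //= D Ds IH; rewrite enc_facts_cat IH. Qed.

Lemma wf_seqs K cs : wf_cmd K (seqs cs) = all (wf_cmd K) cs.
Proof. by elim: cs => //= c cs ->. Qed.

Lemma static_seqs d cs : static d (seqs cs) = all (static d) cs.
Proof. by elim: cs => //= c cs ->. Qed.

Lemma preserves_seqs r cs : preserves r (seqs cs) = all (preserves r) cs.
Proof. by elim: cs => //= c cs ->. Qed.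

Lemma wf_outs K bs : wf_cmd K (outs bs).
Proof. by rewrite wf_seqs all_map; apply/allP. Qed.

Lemma static_outs d bs : static d (outs bs).
Proof. by rewrite static_seqs all_map; apply/allP. Qed.

Lemma preserves_outs r bs : preserves r (outs bs).
Proof. by rewrite preserves_seqs all_map; apply/allP. Qed.

Lemma preserves_out_facts (r u : nat) ts : u != r -> preserves r (out_facts u ts).
Proof.
move=> ne; rewrite preserves_seqs all_map; apply/allP => t _ /=.
rewrite -/(outs _) preserves_outs preserves_seqs all_map /= andbT; apply/allP => e _ /=.
rewrite preserves_outs preserves_seqs all_map andbT; apply/allP => r' _ /=.
by rewrite ne.
Qed.

Definition regs (ts : seq ftemplate) : seq nat := flatten [seq flatten (map fst t.2) | t <- ts].

Lemma out_facts_static K d u ts : u <= K ->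
    {in regs ts, forall r, [&& r <= K, r != u & r != d]} ->
  wf_cmd K (out_facts u ts) && static d (out_facts u ts).
Proof.
move=> leu hr; rewrite wf_seqs static_seqs !all_map -all_predI; apply/allP => t ht /=.
rewrite -!/(outs _) wf_outs static_outs wf_seqs static_seqs !all_map !andbT -all_predI.
apply/allP => e he /=.
rewrite wf_outs static_outs wf_seqs static_seqs !all_map !andbT -all_predI.
apply/allP => r rin /=; have /hr/and3P[-> ne ->]: r \in regs ts.
  by apply/flatten_mapP; exists t => //; apply/flatten_mapP; exists e.
by rewrite leu eq_sym ne.
Qed.

Lemma add_const_static K d k : d <= K -> wf_cmd K (add_const d k) && static d (add_const d k).
Proof.
by move=> le; elim: k => //= k; rewrite le eqxx.
Qed.

Lemma add_power_static K b k r d : b + k <= K -> r < b -> d < b -> r != d ->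
  wf_cmd K (add_power b k r d) && static d (add_power b k r d).
Proof.
move=> + ltr ltd ne.
have pre j n : j < b -> j != d -> preserves j (add_power b n r d).
  by move=> ltj nj; elim: n => [|n IH] /=; rewrite ?IH ?andbT; lia.
have pre' j n : b + n <= j -> preserves j (add_power b n r d).
  by elim: n => [|n IH] le /=; rewrite ?IH ?andbT; lia.
elim: k => [|k IH] le /=; first by rewrite eqxx andbT; lia.
have /andP[-> ->] := IH ltac:(lia).
by rewrite (pre r) // pre' // ne /=; lia.
Qed.

(** * Rules, query and repairs *)

(* Predicates: [pval i t a]: symbol [a] is allowed in cell [i] at time [t]; [psep i t a b] guards the conflict of
   [a] and [b] in that cell; [pforb a b c d]: [d] may not occur below the middle of [a b c]; [phead] is never populated. *)
Definition pval := 1.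
Definition psep := 2.
Definition psucc := 3.
Definition pforb := 4.
Definition phead := 5.

Definition tab_sig : signature :=
  [:: (bot, 0); (pval, 3); (psep, 4); (psucc, 2); (pforb, 4); (phead, 4)].

Definition var (n : nat) : term := inr n.

Definition conflict_rule : dep :=
  {| d_body := [:: LAtom psep [:: var 0; var 1; var 2; var 3];
                   LAtom pval [:: var 0; var 1; var 2];
                   LAtom pval [:: var 0; var 1; var 3];
                   LNeq (var 2) (var 3)];
     d_head := [:: {| cq_ex := [::];
                      cq_body := [:: LAtom phead [:: var 0; var 1; var 2; var 3]] |}] |}.

Definition tab_rules : seq dep := [:: conflict_rule].

(** Variables 0 to 2 are adjacent columns, 3 and 4 consecutive rows, 5 to 8 the symbols of the
    window. One successor relation serves both axes. *)
Definition tab_query : cq :=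
  {| cq_ex := iota 0 9;
     cq_body := [:: LAtom psucc [:: var 0; var 1];
                    LAtom psucc [:: var 1; var 2];
                    LAtom psucc [:: var 3; var 4];
                    LAtom pforb [:: var 5; var 6; var 7; var 8];
                    LAtom pval [:: var 0; var 3; var 5];
                    LAtom pval [:: var 1; var 3; var 6];
                    LAtom pval [:: var 2; var 3; var 7];
                    LAtom pval [:: var 1; var 4; var 8]] |}.

Lemma wf_tab_sig : wf_sig tab_sig.
Proof. by []. Qed.

Lemma wf_tab_rules t : List.In t tab_rules -> wf_dep tab_sig t.
Proof.
move=> [<-|//]; split; [split=> //|split; [|split=> //]].
- by move=> l /= [<-|[<-|[<-|[<-|//]]]].
- move=> v hv; exists psep, [:: var 0; var 1; var 2; var 3]; split; first by left.
  by move: hv; rewrite !inE; lia.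
- move=> c [<-|//]; split; first by split=> // l [<-|//].
  split=> [v hv _|//]; by move: hv; rewrite !inE; lia.
Qed.

Lemma full_tab_rules t : List.In t tab_rules -> full t.
Proof.
move=> [<-|//]; eexists; split; first by [].
by move=> v; rewrite !inE => hv; split=> //; move: hv; lia.
Qed.

Lemma guarded_tab_rules t : List.In t tab_rules -> guarded t.
Proof.
move=> [<-|//]; exists psep, [:: var 0; var 1; var 2; var 3]; split; first by left.
by move=> v; rewrite !inE; lia.
Qed.

Lemma acyclic_tab_rules : acyclic tab_rules.
Proof. by move=> [[|//] hi] [[|//] hj]. Qed.

(* The head predicate occurs in no body and the head contains all variables, so nothing is marked. *)
Lemma sticky_tab_rules : sticky tab_rules.
Proof.
move=> i x m; exfalso; elim: m => {i x}.
- move=> [|//] x _ hx [p [ts [[c [[<-|//] [[_ <-]|//]]]]]].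
  by move: hx; rewrite !inE; lia.
- move=> [|//] x [|//] p ts ts' _ _ hx [c [[<-|//] [[<- _]|//]]].
  by move=> [|[|[|[|//]]]].
Qed.

Lemma safe_tab_query : safe_bcq tab_sig tab_query.
Proof.
split; first by split=> // l /= [<-|[<-|[<-|[<-|[<-|[<-|[<-|[<-|//]]]]]]]].
have hv v : v \in conj_vars (cq_body tab_query) -> v < 9 by rewrite !inE; lia.
split=> v /hv lt; first by rewrite mem_iota.
case: (ltnP v 5) => lt5.
  case: (ltnP v 2) => lt2.
    exists psucc, [:: var 0; var 1]; split; first by left.
    by rewrite !inE; lia.
  case: (ltnP v 3) => lt3.
    exists psucc, [:: var 1; var 2]; split; first by right; left.
    by rewrite !inE; lia.
  exists psucc, [:: var 3; var 4]; split; first by do 2!right; left.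
  by rewrite !inE; lia.
exists pforb, [:: var 5; var 6; var 7; var 8]; split; first by do 3!right; left.
by rewrite !inE; lia.
Qed.

Definition tableau (D : database) (sg : nat -> nat -> nat) : Prop :=
  (forall i t a, (pval, [:: i; t; a]) \in D -> (pval, [:: i; t; sg i t]) \in D) /\
  forall i j k t u,
    (psucc, [:: i; j]) \in D -> (psucc, [:: j; k]) \in D -> (psucc, [:: t; u]) \in D ->
    (pval, [:: i; t; sg i t]) \in D -> (pval, [:: j; t; sg j t]) \in D ->
    (pval, [:: k; t; sg k t]) \in D -> (pval, [:: j; u; sg j u]) \in D ->
    (pforb, [:: sg i t; sg j t; sg k t; sg j u]) \notin D.

Lemma holds_conj_cons D nu l g :
  holds_conj D nu (l :: g) <-> holds_lit D nu l /\ holds_conj D nu g.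
Proof.
split=> [h|[hl hg] l' /= [<-|/hg]] //.
by split=> [|l' hl']; apply: h; [left|right].
Qed.

Lemma bq_holds_tab D : bq_holds D tab_query <-> exists i j k t u a b c d,
  [/\ (psucc, [:: i; j]) \in D, (psucc, [:: j; k]) \in D, (psucc, [:: t; u]) \in D
     & (pforb, [:: a; b; c; d]) \in D] /\
  [/\ (pval, [:: i; t; a]) \in D, (pval, [:: j; t; b]) \in D, (pval, [:: k; t; c]) \in D
     & (pval, [:: j; u; d]) \in D].
Proof.
split=> [[nu [_]]|[i [j [k [t [u [a [b [c [d [[h1 h2 h3 h4] [h5 h6 h7 h8]]]]]]]]]]]].
  move=> /holds_conj_cons[h1 /holds_conj_cons[h2 /holds_conj_cons[h3 /holds_conj_cons[h4]]]].
  move=> /holds_conj_cons[h5 /holds_conj_cons[h6 /holds_conj_cons[h7 /holds_conj_cons[h8 _]]]].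
  by exists (nu 0), (nu 1), (nu 2), (nu 3), (nu 4), (nu 5), (nu 6), (nu 7), (nu 8).
exists (fun v => nth 0 [:: i; j; k; t; u; a; b; c; d] v); split.
  by move=> v; rewrite mem_iota /= => nv; rewrite nth_default //=; lia.
by move=> l /= [<-|[<-|[<-|[<-|[<-|[<-|[<-|[<-|//]]]]]]]].
Qed.

Section Repairs.
Variable D : database.
Hypothesis sepD : forall i t a b, (pval, [:: i; t; a]) \in D -> (pval, [:: i; t; b]) \in D ->
  (psep, [:: i; t; a; b]) \in D.
Hypothesis headD : forall ts, (phead, ts) \notin D.

(** A subset of [D] contains no [phead] fact, so the rule holds only if its body never does. *)
Lemma consistent_tab R : {subset R <= D} ->
  consistent tab_rules R <->
  forall i t a b, (psep, [:: i; t; a; b]) \in R -> (pval, [:: i; t; a]) \in R ->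
    (pval, [:: i; t; b]) \in R -> a = b.
Proof.
move=> sub; split=> [h i t a b hs ha hb|h _ [<-|//] nu hb].
  apply/eqP; apply: contraT => /eqP ne.
  have [|c [[<-|//] [nu [_ /(_ _ (or_introl erefl)) /sub hh]]]] :=
    h conflict_rule (or_introl erefl) (nth 0 [:: i; t; a; b]).
    by move=> l /= [<-|[<-|[<-|[<-|//]]]].
  by case/negP: (headD (map (eval_term nu) [:: var 0; var 1; var 2; var 3])).
exfalso; move: hb => /holds_conj_cons[hs /holds_conj_cons[ha /holds_conj_cons[hb]]].
by move=> /holds_conj_cons[ne _]; apply: ne; apply: (h (nu 0) (nu 1)).
Qed.

(* From a repair falsifying the query, a tableau takes any surviving symbol of each cell; by maximality there is one. *)
Lemma AR_entails_tab : AR_entails tab_rules D tab_query <-> ~ exists sg, tableau D sg.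
Proof.
split=> [ar [sg [dom win]]|nt R [sub [cons max]]].
  pose keep (f : fact) := if f is (1, [:: i; t; a]) then a == sg i t else true.
  (* Only the unselected [pval] facts go. As all guards stay, restoring an unselected symbol clashes
     with the selected one of its cell, which makes [R] maximal. *)
  pose R := filter keep D.
  have sub : {subset R <= D} by move=> f; rewrite mem_filter => /andP[].
  have keepV i t a : (pval, [:: i; t; a]) \in R -> a = sg i t.
    by rewrite mem_filter => /andP[/eqP].
  have cons : consistent tab_rules R.
    by apply/consistent_tab => // i t a b _ /keepV -> /keepV ->.
  have : is_repair tab_rules D R.
    do 2!split=> //; move=> R' subR sub' cons' f fR'; have fD := sub' _ fR'.
    rewrite mem_filter fD andbT; case: f fR' fD => [[|[|p]]] // [|i [|t [|a [|//]]]] //= fR' fD.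
    apply/eqP; have sgD := dom _ _ _ fD.
    move/(consistent_tab sub'): cons'; apply; [|exact: fR'|].
      by apply: subR; rewrite mem_filter; apply: sepD.
    by apply: subR; rewrite mem_filter /= eqxx; apply: dom fD.
  move/ar/bq_holds_tab => [i [j [k [t [u [a [b [c [d [[h1 h2 h3 h4] [h5 h6 h7 h8]]]]]]]]]]].
  move: (keepV _ _ _ h5) (keepV _ _ _ h6) (keepV _ _ _ h7) (keepV _ _ _ h8) => ? ? ? ?; subst.
  apply: (negP (win i j k t u _ _ _ _ _ _ _)); exact: sub.
apply: NNPP => nq; apply: nt.
have maxR f : f \in D -> f \notin R -> consistent tab_rules (f :: R) -> False.
  move=> fD /negP nf cf; apply: nf; apply: max cf _ (mem_head _ _).
    by move=> g gR; rewrite inE gR orbT.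
  by move=> g; rewrite inE => /predU1P[->|/sub].
have maxO f : f \in D -> f.1 != pval -> f.1 != psep -> f \in R.
  move=> fD n1 n2; apply: contraT => /maxR/(_ _)/= h; exfalso; apply: h => //.
  have sub' : {subset f :: R <= D} by move=> g; rewrite inE => /predU1P[->|/sub].
  apply/consistent_tab => // i t a b; rewrite !inE.
  case: eqP => [e|_] /=; first by rewrite -e in n2.
  case: eqP => [e|_] /=; first by rewrite -e in n1.
  case: eqP => [e|_] /=; first by rewrite -e in n1.
  by apply: (iffLR (consistent_tab sub) cons).
(* A clash needs two symbols in the same cell, so a symbol could be added to a cell left empty. *)
have ex i t a : (pval, [:: i; t; a]) \in D -> exists b, (pval, [:: i; t; b]) \in R.
  move=> aD; apply: NNPP => none; apply: (maxR _ aD).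
    by apply/negP => aR; apply: none; exists a.
  have sub' : {subset (pval, [:: i; t; a]) :: R <= D}.
    by move=> g; rewrite inE => /predU1P[->|/sub].
  apply/consistent_tab => // i' t' a' b'; rewrite !inE /=.
  move=> sR; case: (eqVneq b' a') => [->//|ne].
  case: eqP => [ea|_] /=; case: eqP => [eb|_] //=.
  - by case: ea ne eb => -> -> -> /[swap] -[->]; rewrite eqxx.
  - by case: ea => -> -> _ _ bR; case: none; exists b'.
  - by case: eb => -> -> _ aR; case: none; exists a'.
  - by move: sR; apply: (iffLR (consistent_tab sub) cons).
(* The first surviving symbol in the order of the list [R]; several may survive where guards were
   dropped. *)
pose sg i t := nth 0 (head (0, [::])
  [seq f <- R | (f.1 == pval) && (f.2 == [:: i; t; nth 0 f.2 2])]).2 2.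
have sgR i t a : (pval, [:: i; t; a]) \in D -> (pval, [:: i; t; sg i t]) \in R.
  move=> /ex[b bR]; rewrite /sg; set l := filter _ _.
  have: (pval, [:: i; t; b]) \in l by rewrite mem_filter /= !eqxx.
  case el: l => [//|[p ts] l'] _ /=; have: (p, ts) \in l by rewrite el mem_head.
  by rewrite mem_filter /= => /andP[/andP[/eqP-> /eqP <-]].
exists sg; split=> [i t a /sgR/sub //|i j k t u h1 h2 h3 h4 h5 h6 h7].
apply/negP => h8; apply: nq; apply/bq_holds_tab.
exists i, j, k, t, u, (sg i t), (sg j t), (sg k t), (sg j u).
by split; split; first [exact: maxO | exact: sgR h4 | exact: sgR h5 | exact: sgR h6 | exact: sgR h7].
Qed.

End Repairs.

(** * Tableaux of a Turing machine *)

(* Row 0 holds pre-symbols (blank, input bit, guessed bit or end of the guess), the other rows hold tape symbols,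
   one of them together with the state. *)
Notation tile M := (option (bool + option bool) + (tm_sym M + tm_state M * tm_sym M))%type.

Section Tableau.
Variable M : TM.

Local Notation tile := (tile M).

Definition PB : tile := inl None.
Definition PX (b : bool) : tile := inl (Some (inl b)).
Definition PY (o : option bool) : tile := inl (Some (inr o)).
Definition Sy (s : tm_sym M) : tile := inr (inl s).
Definition Hd (q : tm_state M) (s : tm_sym M) : tile := inr (inr (q, s)).

Definition tile_code (a : tile) : nat := enum_rank a.
Definition tile_decode (n : nat) : tile := nth PB (enum {: tile}) n.

Lemma tile_codeK a : tile_decode (tile_code a) = a.
Proof. exact: nth_enum_rank. Qed.

Definition sym_of (o : option bool) : tm_sym M := oapp (@tm_in M) (@tm_blank M) o.

(** The same local rule turns row 0 into the initial configuration: the head goes to the input cell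
    whose left neighbour is [PB]. A halted head stays put, so later rows repeat the final
    configuration. *)
Definition next (a b c : tile) : tile :=
  match b with
  | inl None => Sy (tm_blank M)
  | inl (Some (inl v)) => if a == PB then Hd (tm_start M) (tm_in M v) else Sy (tm_in M v)
  | inl (Some (inr o)) => Sy (sym_of o)
  | inr (inl s) =>
      match a, c with
      | inr (inr (q, u)), _ =>
          if ~~ tm_halt q then
            if tm_delta q u is (q', _, MoveR) then Hd q' s else b
          else b
      | _, inr (inr (q, u)) =>
          if ~~ tm_halt q then
            if tm_delta q u is (q', _, MoveL) then Hd q' s else b
          else b
      | _, _ => b
      end
  | inr (inr (q, s)) =>
      if tm_halt q then b else
      match tm_delta q s with
      | (q', s', MoveS) => Hd q' s'
      | (_, s', _) => Sy s'
      end
  end.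

(** Two demands on neighbours within one row: no guessed bit follows the end of the guess, and a
    halted head sees the output [[:: true]], that is, output bit [true] on its cell and no output
    bit on the next. *)
Definition check (b c : tile) : bool :=
  match b, c with
  | inl (Some (inr None)), inl (Some (inr (Some _))) => false
  | inr (inr (q, s)), inr (inl u) =>
      tm_halt q ==> (tm_out s == Some true) && (tm_out u == None)
  | inr (inr (q, s)), _ => ~~ tm_halt q
  | _, _ => true
  end.

Definition good (a b c d : tile) : bool := (d == next a b c) && check b c.

(** A [config] is relative to the head, the grid is not; [pos] anchors the head at an absolute
    column. *)
Definition sym_at (cf : config M) (pos i : nat) : tm_sym M :=
  let: (_, l, a, r) := cf in
  if i == pos then a else if pos < i then nth (tm_blank M) r (i - pos.+1)
  else nth (tm_blank M) l (pos - i.+1).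

Definition state_of (cf : config M) : tm_state M := let: (q, _, _, _) := cf in q.

Definition track (cf : config M) (pos i : nat) : tile :=
  if i == pos then Hd (state_of cf) (sym_at cf pos i) else Sy (sym_at cf pos i).

Definition new_pos (cf : config M) (pos : nat) : nat :=
  let: (q, _, a, _) := cf in
  if tm_halt q then pos else
  match (tm_delta q a).2 with MoveL => pos.-1 | MoveR => pos.+1 | MoveS => pos end.

Lemma sym_at_step q l a r pos i : 0 < pos -> ~~ tm_halt q ->
  sym_at (tm_step (q, l, a, r)) (new_pos (q, l, a, r) pos) i =
  if i == pos then (tm_delta q a).1.2 else sym_at (q, l, a, r) pos i.
Proof.
move=> p0 /negbTE nh; rewrite /tm_step /new_pos nh; case: (tm_delta q a) => [[q' a'] []].
(* Both branches are a [behead] and a lookup with blank default, which avoids splitting on the end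
   of the tape. *)
- have -> : (match l with
    | [::] => (q', [::], tm_blank M, a' :: r)
    | b :: l' => (q', l', b, a' :: r) end : config M) =
      (q', behead l, nth (tm_blank M) l 0, a' :: r) by case: (l).
  case: pos p0 => // pos _ /=; rewrite nth_behead.
  case: (ltngtP i pos) => [lt|gt|->].
  + have [-> ->] : (i == pos.+1) = false /\ (pos.+1 < i) = false by lia.
    by rewrite subSn.
  + case: (eqVneq i pos.+1) => [->|ne]; first by rewrite subnn.
    have -> : i - pos.+1 = (i - pos.+2).+1 by lia.
    by have -> : pos.+1 < i by lia.
  + have [-> ->] : (pos == pos.+1) = false /\ (pos.+1 < pos) = false by lia.
    by rewrite subSS subnn.
- have -> : (match r with
    | [::] => (q', a' :: l, tm_blank M, [::])
    | b :: r' => (q', a' :: l, b, r') end : config M) =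
      (q', a' :: l, nth (tm_blank M) r 0, behead r) by case: (r).
  rewrite /= nth_behead.
  case: (ltngtP i pos.+1) => [lt|gt|->].
  + case: (eqVneq i pos) => [->|ne]; first by rewrite subnn.
    by have -> : pos.+1 - i.+1 = (pos - i.+1).+1 by lia.
  + have -> : (i == pos) = false by lia.
    by have -> : (i - pos.+2).+1 = i - pos.+1 by lia.
  + have -> : (pos.+1 == pos) = false by lia.
    by rewrite subnn.
- by rewrite /=; case: eqP.
Qed.

Lemma state_of_step q l a r : ~~ tm_halt q ->
  state_of (tm_step (q, l, a, r)) = (tm_delta q a).1.1.
Proof.
move=> /negbTE nh; rewrite /tm_step nh.
by case: (tm_delta q a) => [[q' a'] []]; [case: l|case: r|].
Qed.

Lemma track_step cf pos i : 0 < pos -> 0 < i ->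
  track (tm_step cf) (new_pos cf pos) i =
  next (track cf pos i.-1) (track cf pos i) (track cf pos i.+1).
Proof.
case: cf => [[[q l] a] r] p0 i0.
case: (boolP (tm_halt q)) => h.
  rewrite /tm_step /new_pos h /track /next [state_of _]/=.
  by case: (i == pos); case: (i.-1 == pos); case: (i.+1 == pos); rewrite /= ?h.
have sa : sym_at (q, l, a, r) pos pos = a by rewrite /= eqxx.
rewrite /track sym_at_step // state_of_step // [state_of _]/=.
move: (sym_at _ pos) sa => S sa; rewrite /new_pos (negbTE h).
case: (ltngtP i pos) => [lt|gt|->]; last first.
- rewrite sa /= (negbTE h); case: (tm_delta q a) => [[q' a'] []] /=.
  + by have -> : (pos == pos.-1) = false by lia.
  + by have -> : (pos == pos.+1) = false by lia.
  + by rewrite eqxx.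
- have -> : (i.+1 == pos) = false by lia.
  case: (eqVneq i pos.+1) => [->|ne].
    rewrite eqxx sa /= h; case: (tm_delta q a) => [[q' a'] []] /=.
    + by have -> : (pos.+1 == pos.-1) = false by lia.
    + by rewrite eqxx.
    + by have -> : (pos.+1 == pos) = false by lia.
  have -> /= : (i.-1 == pos) = false by lia.
  have -> // : (i == match (tm_delta q a).2 with
    | MoveL => pos.-1 | MoveR => pos.+1 | MoveS => pos end) = false.
  by case: (tm_delta q a).2; lia.
- have -> : (i.-1 == pos) = false by lia.
  case: (eqVneq i.+1 pos) => [e|ne] /=.
    rewrite e sa h; case: (tm_delta q a) => [[q' a'] []] /=.
    + by have -> : i == pos.-1 by lia.
    + by have -> : (i == pos.+1) = false by lia.
    + by have -> : (i == pos) = false by lia.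
  have -> // : (i == match (tm_delta q a).2 with
    | MoveL => pos.-1 | MoveR => pos.+1 | MoveS => pos end) = false.
  by case: (tm_delta q a).2; lia.
Qed.

(** * The space-time grid of one input *)

Section Rows.
Variables (x : seq bool) (p c : nat).

(** The part of [pair_enc x y] that does not depend on [y]. The certificate is a suffix, so the
    guessed cells come right after it. *)
Definition z0 : seq bool := pair_enc x [::].
Definition width : nat := c + (size z0 + p) + c.

Definition guess : seq tile := [:: PY None; PY (Some false); PY (Some true)].

Definition row0_allowed (i : nat) : seq tile :=
  if i < c then [:: PB] else
  if i < c + size z0 then [:: PX (nth false z0 (i - c))] else
  if i < c + (size z0 + p) then guess else [:: PB].

Lemma row0_allowed_head i : head PB (row0_allowed i) \in row0_allowed i.
Proof. by rewrite /row0_allowed; do 3?case: ifP => _ //; rewrite !inE eqxx. Qed.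

Variable D : database.
Hypothesis succD : forall i j, (psucc, [:: i; j]) \in D <-> i < width /\ j = i.+1.
Hypothesis valD : forall i t a, (pval, [:: i; t; a]) \in D <->
  [/\ i < width, t <= c & exists2 s, a = tile_code s & t = 0 -> s \in row0_allowed i].
Hypothesis forbD : forall ta tb tc td,
  (pforb, map tile_code [:: ta; tb; tc; td]) \in D <-> ~~ good ta tb tc td.

Definition row0 (y : seq bool) (i : nat) : tile :=
  if i < c then PB else
  if i < c + size z0 then PX (nth false z0 (i - c)) else
  if i < c + (size z0 + p) then PY (onth y (i - c - size z0)) else PB.

Lemma pair_encE y : pair_enc x y = z0 ++ y.
Proof. by rewrite /z0 /pair_enc -catA. Qed.

Lemma size_pair_enc : size z0 = size x + size x + 2.
Proof.
rewrite /z0 /pair_enc !size_cat /=; congr (_ + _).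
by elim: x => //= b s ->; lia.
Qed.

Lemma sym_at_init z i : z != [::] ->
  sym_at (tm_init M z) c i = if i < c then tm_blank M else sym_of (onth z (i - c)).
Proof.
case: z => //= b z _; case: (ltngtP i c) => [lt|gt|->]; last by rewrite subnn.
  by rewrite nth_nil.
have -> : i - c = (i - c.+1).+1 by lia.
rewrite /= onthE; case: (ltnP (i - c.+1) (size z)) => lt.
  by rewrite !(nth_map false).
by rewrite !nth_default ?size_map.
Qed.

Lemma state_of_init z : state_of (tm_init M z) = tm_start M.
Proof. by case: z. Qed.

Lemma next_row0 y i : size y <= p -> 0 < c -> 0 < i ->
  next (row0 y i.-1) (row0 y i) (row0 y i.+1) = track (tm_init M (pair_enc x y)) c i.
Proof.
move=> ley c0 i0; have z2 := size_pair_enc.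
have nz : pair_enc x y != [::] by rewrite pair_encE; case: z0 z2 => //=; rewrite addn2.
rewrite /track state_of_init sym_at_init // pair_encE onth_cat /row0.
case: (ltnP i c) => [lt|ge]; first by rewrite ltn_eqF.
have -> : (i - c < size z0) = (i < c + size z0) by lia.
case: (ltnP i (c + size z0)) => [lt|ge2].
  have -> : onth z0 (i - c) = Some (nth false z0 (i - c)).
    by rewrite onthE (nth_map false) //; lia.
  rewrite /= /next; case: (eqVneq i c) => [->|ne]; first by rewrite prednK // leqnn eqxx.
  have [-> ->] : (i.-1 < c) = false /\ i.-1 < c + size z0 by lia.
  by [].
have -> : (i == c) = false by lia.
case: (ltnP i (c + (size z0 + p))) => [lt|ge3] //=.
by rewrite onth_default //=; lia.
Qed.

Fixpoint run_tm (y : seq bool) (t : nat) : config M * nat :=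
  if t is t'.+1 then let cp := run_tm y t' in (tm_step cp.1, new_pos cp.1 cp.2)
  else (tm_init M (pair_enc x y), c).

Lemma run_tm_iter y t : (run_tm y t).1 = iter t (@tm_step M) (tm_init M (pair_enc x y)).
Proof. by elim: t => //= t ->. Qed.

Lemma run_tm_pos y t : c - t <= (run_tm y t).2 <= c + t.
Proof.
elim: t => [|t IH] /=; first by rewrite subn0 addn0 leqnn.
case: (run_tm y t) IH => [[[[q l] a] r] pos] /=.
by case: ifP => // _; [lia|case: (tm_delta q a).2; lia].
Qed.

Lemma tableau_good sg : tableau D sg -> forall i t, 0 < i -> i.+1 < width -> t < c ->
  good (tile_decode (sg i.-1 t)) (tile_decode (sg i t)) (tile_decode (sg i.+1 t))
       (tile_decode (sg i t.+1)).
Proof.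
move=> [dom win] i t i0 ltw ltc.
(* [psucc] is populated up to the number of columns but also orders the rows, so the rows must not
   outnumber the columns. *)
have cw : c <= width by rewrite /width; lia.
have inD j u : j < width -> u <= c -> (pval, [:: j; u; sg j u]) \in D.
  move=> ltj leu; have [s hs] : exists s, u = 0 -> s \in row0_allowed j.
    by eexists=> _; apply: row0_allowed_head.
  by apply: (dom _ _ (tile_code s)); apply/valD; split=> //; exists s.
have dec j u : j < width -> u <= c -> tile_code (tile_decode (sg j u)) = sg j u.
  by move=> ltj leu; have /valD[_ _ [s -> _]] := inD j u ltj leu; rewrite tile_codeK.
have /negP nf : (pforb, [:: sg i.-1 t; sg i t; sg i.+1 t; sg i t.+1]) \notin D.
  by apply: win; first [apply/succD; lia | apply: inD; lia].
apply: contraT => /forbD; rewrite /= !dec; try lia.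
by move/nf.
Qed.

(** The string is cut at the first [None]. The hypothesis is what [check] enforces between adjacent
    guessed cells. *)
Lemma guess_string (g : nat -> option bool) n :
  (forall j, j.+1 < n -> g j = None -> g j.+1 = None) ->
  exists2 y, size y <= n & forall j, j < n -> g j = onth y j.
Proof.
elim: n g => [|n IH] g hg; first by exists [::].
case e: (g 0) => [b|].
  have [|y ly hy] := IH (g \o succn); first by move=> j ltj; apply: (hg j.+1).
  by exists (b :: y) => // -[|j] // ltj; rewrite [RHS]/= -hy.
exists [::] => // j ltj; rewrite onth_default //; elim: j ltj => // j IHj ltj.
by apply: hg => //; apply: IHj; apply: ltnW.
Qed.

Lemma tableau_row0 sg : 0 < c -> tableau D sg -> exists2 y, size y <= p &
  forall i, i < width -> tile_decode (sg i 0) = row0 y i.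
Proof.
move=> c0 tab; have z2 := size_pair_enc.
have row i : i < width -> tile_decode (sg i 0) \in row0_allowed i.
  move=> ltw; have [dom _] := tab.
  have : (pval, [:: i; 0; tile_code (head PB (row0_allowed i))]) \in D.
    by apply/valD; split=> //; eexists=> // _; apply: row0_allowed_head.
  by move/dom/valD => [_ _ [s -> /(_ erefl)]]; rewrite tile_codeK.
pose g j := if tile_decode (sg (c + size z0 + j) 0) is inl (Some (inr o)) then o else None.
have gE j : j < p -> tile_decode (sg (c + size z0 + j) 0) = PY (g j).
  move=> ltj; have := row (c + size z0 + j); rewrite /row0_allowed /width /g.
  have -> : (c + size z0 + j < c) = false by lia.
  have -> : (c + size z0 + j < c + size z0) = false by lia.
  have -> : (c + size z0 + j < c + (size z0 + p)) by lia.
  rewrite /guess !inE => h; have := h ltac:(lia).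
  by case/or3P => /eqP ->.
have [|y ley hy] := @guess_string g p.
  move=> j ltj gn; have := tableau_good tab (i := c + size z0 + j) (t := 0).
  rewrite -addnS !gE; [|lia..]; rewrite gn /width => h.
  have /andP[_] := h ltac:(lia) ltac:(lia) c0.
  by case: (g j.+1).
exists y => // i ltw; move: (row i ltw); rewrite /row0_allowed /row0.
case: ifP => [_|lt1]; first by rewrite inE => /eqP.
case: ifP => [_|lt2]; first by rewrite inE => /eqP.
case: ifP => [lt3 _|_]; last by rewrite inE => /eqP.
have e : c + size z0 + (i - c - size z0) = i by lia.
by rewrite -hy -?gE ?e //; lia.
Qed.

Variables (N : nat) (F : seq bool -> seq bool).
(** After at most [N] steps the head is at column [N + 3] or beyond, whereas in row [N + 1] the left
    edge has affected only the columns up to [N]. The same [c] is the index of the last row, which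
    leaves room for the window below the halted row. *)
Hypothesis cN : c = N + N + 3.
Hypothesis haltN : forall y, size y <= p -> exists n, n <= N /\
  tm_halted (iter n (@tm_step M) (tm_init M (pair_enc x y))) /\
  tm_output (iter n (@tm_step M) (tm_init M (pair_enc x y))) = F (pair_enc x y).

(* The ends of the rows are unconstrained, but their influence spreads by one cell per step and does not reach the head. *)
Lemma tableau_track sg y : size y <= p -> tableau D sg ->
  (forall i, i < width -> tile_decode (sg i 0) = row0 y i) ->
  forall t i, t < c -> t < i -> i + t.+1 < width ->
    tile_decode (sg i t.+1) = track (run_tm y t).1 (run_tm y t).2 i.
Proof.
move=> ley tab r0; elim=> [|t IH] i ltc lti ltw.
  have /andP[/eqP -> _] := tableau_good tab lti ltac:(lia) ltc.
  by rewrite !r0; [apply: next_row0; lia|lia..].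
have /andP[/eqP -> _] : good _ _ _ _ := tableau_good tab (t := t.+1) (i := i) ltac:(lia) ltac:(lia) ltc.
have := run_tm_pos y t => hp.
by rewrite !IH; [rewrite -track_step //; lia|lia..].
Qed.

Lemma tableau_accepts sg : tableau D sg -> exists2 y, size y <= p & F (pair_enc x y) = [:: true].
Proof.
move=> tab; have [|y ley r0] := tableau_row0 _ tab; first lia.
exists y => //; have [n [len [+ <-]]] := haltN ley.
have tr := tableau_track ley tab r0; have := run_tm_pos y n.
move: (tr n) => {tr}; rewrite -run_tm_iter.
case: (run_tm y n) => [[[[q l] a] r] pos] /= tr hpos hq.
(* Row [n.+1] holds the configuration after [n] steps, because row 0 holds the pre-symbols. *)
have /andP[_] := tableau_good tab (t := n.+1) (i := pos) ltac:(lia)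
  ltac:(rewrite /width; lia) ltac:(lia).
rewrite !tr; [|rewrite /width; lia..].
rewrite /track /= eqxx.
have -> : (pos.+1 == pos) = false by lia.
have -> : pos < pos.+1 by lia.
rewrite subnn /= hq /= => /andP[/eqP -> /eqP].
by case: r {tr} => //= b r ->.
Qed.

Lemma iter_halted (cf : config M) n : tm_halted cf -> iter n (@tm_step M) cf = cf.
Proof. by case: cf => [[[q l] a] r] /= h; elim: n => //= n ->; rewrite /tm_step h. Qed.

(** Both sides equal the configuration after [n + t] steps, since halted configurations are fixed.
    Hence every halted row shows the same output. *)
Lemma halted_unique (cf : config M) n t :
  tm_halted (iter n (@tm_step M) cf) -> tm_halted (iter t (@tm_step M) cf) ->
  iter n (@tm_step M) cf = iter t (@tm_step M) cf.
Proof.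
move=> /(iter_halted t) en /(iter_halted n) et.
by move: en et; rewrite -!iterD addnC => -> ->.
Qed.

Lemma accepts_tableau y : size y <= p -> F (pair_enc x y) = [:: true] -> exists sg, tableau D sg.
Proof.
move=> ley hF; have z2 := size_pair_enc.
pose tl i t := if t is t'.+1 then track (run_tm y t').1 (run_tm y t').2 i else row0 y i.
exists (fun i t => tile_code (tl i t)); split.
  move=> i t a /valD[ltw lec _]; apply/valD; split=> //; exists (tl i t) => // ->.
  rewrite /= /row0 /row0_allowed; do 3?case: ifP => _ //; rewrite ?inE ?eqxx //.
  by case: (onth _ _) => [[]|]; rewrite eqxx ?orbT.
move=> i j k t u /succD[_ ->] /succD[_ ->] /succD[_ ->] _ _ _ /valD[ltw lec _].
apply/negP => /(forbD (tl i t) (tl i.+1 t) (tl i.+2 t) (tl i.+1 t.+1)) /negP; apply.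
rewrite /good; case: t lec => [|t] lec /=.
  have c0 : 0 < c by lia.
  rewrite -(next_row0 (i := i.+1)) ?eqxx //=.
  rewrite /row0 /=; do 3?case: ifP => //= ?; do 3?case: ifP => //= ?;
    try by case: (onth y _).
  (* The only case left is a bit right after the end of the certificate, which a string excludes. *)
  case e: (onth y _) => [//|]; case e': (onth y _) => [b|//].
  have: size y <= i.+2 - c - size z0.
    move: e; rewrite onthE; case: (ltnP (i.+1 - c - size z0) (size y)) => h; last by lia.
    by rewrite (nth_map false).
  by move/onth_default => en; rewrite en in e'.
(* The head starts at column [c], moves at most one column per row, and [c] is the last row, so it
   cannot get to column 0. *)
have pos0 : 0 < (run_tm y t).2 by have := run_tm_pos y t; lia.
rewrite -(track_step (run_tm y t).1 pos0 (ltn0Sn i)) eqxx.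
have : tm_halted (run_tm y t).1 -> tm_output (run_tm y t).1 = [:: true].
  rewrite run_tm_iter => ht; have [n [_ [hn e]]] := haltN ley.
  by rewrite (halted_unique ht hn) e hF.
case: (run_tm y t) {pos0} => [[[[q l] a] r] pos].
rewrite /track /=; case: (eqVneq i.+1 pos) => [<-|ne] //=.
have -> : (i.+2 == i.+1) = false by lia.
rewrite ltnSn subnn => h; apply/implyP => /h.
case: (tm_out a) => // -[] //=; case: r {h} => [|b r] /=; first by rewrite tm_out_blank.
by case: (tm_out b).
Qed.

End Rows.
End Tableau.

(** * The database of an input *)

Section Reduction.
(* [M] verifies in time [n ^ k + k] certificates of length at most [n ^ l + l]. *)
Variables (M : TM) (k l : nat).
Local Notation tile := (tile M).
Local Notation code := (@tile_code M).

Definition cert_size (n : nat) : nat := n ^ l + l.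
(** The length of a pair with a longest certificate. The factor [1 *] copies the loops of
    [dims_cmd], so that the registers agree by conversion. *)
Definition row_input (n : nat) : nat := 2 * n + 1 * cert_size n + 2.
(** The time bound at the longest pair, which covers all shorter certificates by monotonicity. *)
Definition run_time (n : nat) : nat := row_input n ^ k + k.
Definition margin (n : nat) : nat := 2 * run_time n + 3.
Definition row_size (n : nat) : nat := 2 * margin n + 1 * row_input n.

Definition dims (n : nat) : seq nat :=
  [:: n; cert_size n; row_input n; run_time n; margin n; row_size n].

(** Guards are given for all pairs of tiles in every cell; a guard has no effect unless both symbols
    are present there. *)
Definition cell_facts (g : seq tile) (i t : nat) : seq fact :=
  [seq (pval, [:: i; t; code a]) | a <- g] ++
  [seq (psep, [:: i; t; code a; code b]) | a <- enum {: tile}, b <- enum {: tile}].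

Definition forb_args : seq (tile * tile * (tile * tile)) :=
  [seq q <- enum {: tile * tile * (tile * tile)} | ~~ good q.1.1 q.1.2 q.2.1 q.2.2].

Definition forb_facts : seq fact :=
  [seq (pforb, map code [:: q.1.1; q.1.2; q.2.1; q.2.2]) | q <- forb_args].

Section Database.
Variable x : seq bool.
Let n := size x.
Let c := margin n.

(** Left margin, doubled input bits, delimiter, guesses, right margin, later rows. Order and
    arithmetic are those of the printing loops, because the encoding of a database depends on the
    order of its facts. *)
Definition cells : seq (seq tile * nat * nat) :=
  [seq ([:: PB M], j, 0) | j <- iota 0 c] ++
  flatten [seq [:: ([:: PX M (nth false x j)], c + (j + j), 0);
                   ([:: PX M (nth false x j)], c + (j + j) + 1, 0)] | j <- iota 0 n] ++
  [:: ([:: PX M false], c + (n + n), 0); ([:: PX M true], c + (n + n) + 1, 0)] ++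
  [seq (guess M, c + (n + (n + j)) + 2, 0) | j <- iota 0 (cert_size n)] ++
  [seq ([:: PB M], c + (row_input n + j), 0) | j <- iota 0 c] ++
  flatten [seq [seq (enum {: tile}, j, t + 1) | j <- iota 0 (row_size n)] | t <- iota 0 c].

Definition db : database :=
  flatten [seq cell_facts q.1.1 q.1.2 q.2 | q <- cells] ++
  [seq (psucc, [:: j; j + 1]) | j <- iota 0 (row_size n)] ++ forb_facts.

Lemma widthE : width x (cert_size n) c = row_size n.
Proof.
by rewrite /width size_pair_enc -/n /row_size -/c /row_input; lia.
Qed.

Lemma nth_z0 j : nth false (z0 x) j =
  if j < n + n then nth false x j./2 else j == (n + n).+1.
Proof.
rewrite /z0 /pair_enc /n; elim: x j => [|b s IH] [|[|j]] //=; first by rewrite nth_nil.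
  by rewrite addnS.
by rewrite IH addnS addSn !ltnS.
Qed.

Lemma cellsP g i t : (g, i, t) \in cells <->
  [/\ i < row_size n, t <= c & g = if t == 0 then row0_allowed M x (cert_size n) c i else enum {: tile}].
Proof.
have z2 : size (z0 x) = n + n + 2 by exact: size_pair_enc.
have ri : row_size n = c + row_input n + c by rewrite /row_size -/c; lia.
have rp : row_input n = n + n + 2 + cert_size n by rewrite /row_input; lia.
have allowedX j : j < n + n + 2 ->
    row0_allowed M x (cert_size n) c (c + j) = [:: PX M (nth false (z0 x) j)].
  move=> ltj; rewrite /row0_allowed z2 ltnNge leq_addr /=.
  by rewrite ltn_add2l ltj addKn.
split.
- rewrite !mem_cat => /orP[/mapP[j]|].
    rewrite mem_iota => /andP[_ ltj] [-> -> ->]; split=> //; first by lia.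
    by rewrite /row0_allowed; have -> : j < c by [].
  case/orP => [/flatten_mapP[j]|].
    rewrite mem_iota => /andP[_ ltj]; rewrite !inE => /orP[]/eqP[-> -> ->]; split=> //; try lia.
      rewrite allowedX ?nth_z0; last lia.
      have -> : j + j < n + n by lia.
      by rewrite addnn doubleK.
    rewrite -addnA addn1 allowedX ?nth_z0; last lia.
    have -> : (j + j).+1 < n + n by lia.
    by rewrite addnn -[j.*2.+1]/(true + j.*2) half_bit_double.
  case/orP => [|].
    rewrite !inE => /orP[]/eqP[-> -> ->]; split=> //; try lia.
      rewrite allowedX ?nth_z0; last lia.
      by rewrite ltnn (ltn_eqF (ltnSn _)).
    rewrite -addnA addn1 allowedX ?nth_z0; last lia.
    have -> : ((n + n).+1 < n + n) = false by lia.
    by rewrite /= eqxx.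
  case/orP => [/mapP[j]|].
    rewrite mem_iota => /andP[_ ltj] [-> -> ->]; split=> //; first by lia.
    rewrite /row0_allowed z2; do 2!(case: ifP => [?|_]; first lia).
    by case: ifP => // ?; lia.
  case/orP => [/mapP[j]|].
    rewrite mem_iota => /andP[_ ltj] [-> -> ->]; split=> //; first by lia.
    rewrite /row0_allowed z2; do 2!(case: ifP => [?|_]; first lia).
    by case: ifP => // ?; lia.
  case/flatten_mapP=> t'; rewrite mem_iota => /andP[_ ltt] /mapP[j].
  rewrite mem_iota => /andP[_ ltj] [-> -> ->]; split=> //; try lia.
  by rewrite addn1.
- case=> lti let0; rewrite !mem_cat; case: eqP => [-> ->|/eqP t0 ->]; last first.
    do 5!(apply/orP; right); apply/flatten_mapP; exists t.-1; first by rewrite mem_iota; lia.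
    by apply/mapP; exists i; [rewrite mem_iota; lia|congr (_, _, _); lia].
  rewrite /row0_allowed z2; case: ifP => [lt|ge].
    by apply/orP; left; apply/mapP; exists i => //; rewrite mem_iota.
  apply/orP; right; case: ifP => [lt|ge2].
    have [j ej] : exists j, i = c + j by exists (i - c); lia.
    rewrite ej addKn nth_z0; case: ifP => [ltj|gej].
      (* Column [j] of the doubled part comes from bit [j./2]; its parity tells the first copy from
         the second. *)
      apply/orP; left; apply/flatten_mapP; exists j./2.
        by rewrite mem_iota; have := odd_double_half j; lia.
      have := odd_double_half j; rewrite -addnn !inE; case: (odd j) => /= e.
        by apply/orP; right; apply/eqP; congr (_, _, _); lia.
      by apply/orP; left; apply/eqP; congr (_, _, _); lia.
    apply/orP; right; apply/orP; left; rewrite !inE.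
    case: (eqVneq j (n + n).+1) => [->|ne]; apply/orP; [right|left]; apply/eqP;
      congr (_, _, _); lia.
  do 2!(apply/orP; right); case: ifP => [lt|ge3]; apply/orP; [left|right].
    apply/mapP; exists (i - c - (n + n + 2)); first by rewrite mem_iota; lia.
    by congr (_, _, _); lia.
  apply/orP; left; apply/mapP; exists (i - c - row_input n); first by rewrite mem_iota; lia.
  by congr (_, _, _); lia.
Qed.

End Database.

Lemma dbP x f : f \in db x <->
  [\/ exists g i t, (g, i, t) \in cells x /\ f \in cell_facts g i t,
      exists2 j, j < row_size (size x) & f = (psucc, [:: j; j.+1]) |
      exists2 q : tile * tile * (tile * tile), ~~ good q.1.1 q.1.2 q.2.1 q.2.2 &
        f = (pforb, map code [:: q.1.1; q.1.2; q.2.1; q.2.2])].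
Proof.
rewrite !mem_cat; split.
- case/or3P => [/flatten_mapP[[[g i] t] hq hf]|/mapP[j]|/mapP[q]].
  + by apply: Or31; exists g, i, t.
  + by rewrite mem_iota addn1 => hj ->; apply: Or32; exists j.
  + by rewrite mem_filter => /andP[hq _] ->; apply: Or33; exists q.
- case=> [[g [i [t [hq hf]]]]|[j hj ->]|[q hq ->]]; apply/or3P.
  + by apply: Or31; apply/flatten_mapP; exists (g, i, t).
  + by apply: Or32; apply/mapP; exists j; rewrite ?mem_iota ?addn1.
  + by apply: Or33; apply/mapP; exists q => //; rewrite mem_filter hq mem_enum.
Qed.

Lemma cell_factsP g i t f : f \in cell_facts g i t <->
  (exists2 a, a \in g & f = (pval, [:: i; t; code a])) \/
  (exists a b, f = (psep, [:: i; t; code a; code b])).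
Proof.
rewrite mem_cat; split.
- case/orP => [/mapP[a ha ->]|/allpairsP[[a b] [_ _ ->]]]; first by left; exists a.
  by right; exists a, b.
- case=> [[a ha ->]|[a [b ->]]]; apply/orP; first by left; apply/mapP; exists a.
  by right; apply/allpairsP; exists (a, b); rewrite !mem_enum.
Qed.

Lemma wf_db_db x : wf_db tab_sig (db x).
Proof.
move=> f /dbP[[g [i [t [_ /cell_factsP[[a _ ->]|[a [b ->]]]]]]]|[j _ ->]|[q _ ->]]; by [].
Qed.

Lemma db_val x i t a : (pval, [:: i; t; a]) \in db x <->
  [/\ i < width x (cert_size (size x)) (margin (size x)), t <= margin (size x)
    & exists2 s, a = code s & t = 0 -> s \in row0_allowed M x (cert_size (size x)) (margin (size x)) i].
Proof.
rewrite widthE; split.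
- case/dbP => [[g [i' [t' [/cellsP[h1 h2 h3] /cell_factsP[[s hs]|[? [? //]]]]]]]|[j _ //]|[q _ //]].
  case=> -> -> ->; split=> //; exists s => // t0; move: hs; rewrite h3 t0 eqxx //.
- move=> [h1 h2 [s -> hs]]; apply/dbP; apply: Or31.
  exists (if t == 0 then row0_allowed M x (cert_size (size x)) (margin (size x)) i
    else enum {: tile}), i, t.
  split; first exact/cellsP.
  apply/cell_factsP; left; exists s => //.
  by case: eqP => [/hs //|_]; rewrite mem_enum.
Qed.

Lemma db_succ x i j : (psucc, [:: i; j]) \in db x <->
  i < width x (cert_size (size x)) (margin (size x)) /\ j = i.+1.
Proof.
rewrite widthE; split.
- case/dbP => [[g [i' [t' [_ /cell_factsP[[? _ //]|[? [? //]]]]]]]|[j' hj]|[q _ //]].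
  by case=> -> ->.
- by move=> [h ->]; apply/dbP; apply: Or32; exists i.
Qed.

Lemma db_forb x (a b c d : tile) :
  (pforb, map code [:: a; b; c; d]) \in db x <-> ~~ good a b c d.
Proof.
split=> [|h].
- case/dbP => [[g [i' [t' [_ /cell_factsP[[? _ //]|[? [? //]]]]]]]|[? _ //]|[q hq]].
  by case=> /(can_inj (@tile_codeK M))-> /(can_inj (@tile_codeK M))->
    /(can_inj (@tile_codeK M))-> /(can_inj (@tile_codeK M))->.
- by apply/dbP; apply: Or33; exists (a, b, (c, d)).
Qed.

Lemma db_sep x i t a b : (pval, [:: i; t; a]) \in db x -> (pval, [:: i; t; b]) \in db x ->
  (psep, [:: i; t; a; b]) \in db x.
Proof.
case/dbP => [[g [i' [t' [hq /cell_factsP[[s _]|[? [? //]]]]]]]|[? _ //]|[? _ //]].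
case=> -> -> -> /db_val[_ _ [s' -> _]].
by apply/dbP; apply: Or31; exists g, i', t'; split=> //; apply/cell_factsP; right; exists s, s'.
Qed.

Lemma db_head x ts : (phead, ts) \notin db x.
Proof.
apply/negP => /dbP[[g [i' [t' [_ /cell_factsP[[? _ //]|[? [? //]]]]]]]|[? _ //]|[? _ //]].
Qed.

Lemma AR_entails_db (F : seq bool -> seq bool) x : computes_in M F (fun n => n ^ k + k) ->
  AR_entails tab_rules (db x) tab_query <->
  ~ exists y, size y <= size x ^ l + l /\ F (pair_enc x y) = [:: true].
Proof.
move=> hM.
have haltN y : size y <= cert_size (size x) -> exists n, n <= run_time (size x) /\
    tm_halted (iter n (@tm_step M) (tm_init M (pair_enc x y))) /\
    tm_output (iter n (@tm_step M) (tm_init M (pair_enc x y))) = F (pair_enc x y).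
  move=> ley; have [n [len h]] := hM (pair_enc x y); exists n; split=> //.
  apply: leq_trans len _; rewrite leq_add2r; apply: expn_monol.
  by rewrite pair_encE size_cat size_pair_enc /row_input; lia.
have cN : margin (size x) = run_time (size x) + run_time (size x) + 3 by rewrite /margin; lia.
rewrite (AR_entails_tab (@db_sep x) (@db_head x)).
split=> nt [].
- move=> y [ley hy]; apply: nt.
  exact: (accepts_tableau (@db_succ x) (@db_val x) (@db_forb x) cN haltN ley hy).
- move=> sg tab; apply: nt.
  have [y ley hy] := tableau_accepts (@db_succ x) (@db_val x) (@db_forb x) cN haltN tab.
  by exists y.
Qed.

End Reduction.

Lemma run_for_add_const x i r d k s : s.1 i = 0 -> i != d ->
  run x (For i r (add_const d k)) s = setr s d (s.1 d + k * s.1 r).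
Proof.
move=> si ne; apply: run_for_add => // j v _.
by rewrite run_add_const setr_set /= eqxx.
Qed.

Lemma run_for_facts x i r u ts s : s.1 i = 0 -> s.1 u = 0 -> u != i ->
  run x (For i r (out_facts u ts)) s =
  appo s (enc_facts (flatten [seq map (feval ((setr s i j).1, [::])) ts | j <- iota 0 (s.1 r)])).
Proof.
move=> si su ne; rewrite enc_facts_flatten -map_comp; apply: run_for_out => // j o _.
by rewrite run_out_facts //= (negbTE ne).
Qed.

Ltac poly := rewrite /row_size /margin /run_time /row_input /cert_size /=;
  repeat first [exact: poly_bounded_size | exact: poly_bounded_const
    | apply: poly_bounded_add | apply: poly_bounded_mul | apply: poly_bounded_exp ].

(** * The program computing the dimensions of the grid *)

Section Program.
Variables (M : TM) (k l : nat).
Local Notation tile := (tile M).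
Local Notation code := (@tile_code M).

(* Registers: [size x] and the other [dims], loop counters 6 and 7, counter 8 of the unary printer,
   counters 9, ... of the powers. *)
Definition power_cmds (d r e : nat) : cmd := Seq (add_power 9 e r d) (add_const d e).

Definition dims_cmd : cmd :=
  Seq (power_cmds 1 0 l)
  (Seq (For 6 0 (add_const 2 2)) (Seq (For 6 1 (add_const 2 1)) (Seq (add_const 2 2)
  (Seq (power_cmds 3 2 k)
  (Seq (For 6 3 (add_const 4 2)) (Seq (add_const 4 3)
  (Seq (For 6 4 (add_const 5 2)) (For 6 2 (add_const 5 1))))))))).

Definition reg_bound : nat := 9 + (l + k).

Definition dims_state (n : nat) : state := mkstate (dims k l n) [::].

Lemma polyrun_step K d c (v v' : seq bool -> seq nat) (w : seq bool -> nat) :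
    wf_cmd K c && static d c -> poly_bounded (fun x => sumn (v x)) ->
    (forall x, run x c (mkstate (v x) [::]) = setr (mkstate (v x) [::]) d (w x)) ->
    (forall x, set_nth 0 (v x) d (w x) = v' x) ->
  polyrun K c (fun x => mkstate (v x) [::]) (fun x => mkstate (v' x) [::]).
Proof.
move=> /andP[w1 s1] pv hr hv; apply: polyrun_static w1 s1 pv _ => x.
by rewrite hr setr_mkstate hv.
Qed.

Lemma polyrun_dims : polyrun reg_bound dims_cmd init_state (fun x => dims_state (size x)).
Proof.
have power d r e (v v' : seq bool -> seq nat) : e <= l + k -> r < 9 -> d < 9 -> r != d ->
    (forall x, size (v x) = d) -> poly_bounded (fun x => sumn (v x)) ->
    (forall x, rcons (v x) (nth 0 (v x) r ^ e + e) = v' x) ->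
    polyrun reg_bound (power_cmds d r e) (fun x => mkstate (v x) [::]) (fun x => mkstate (v' x) [::]).
  move=> lee ltr ltd ne sv pv hv.
  apply: (@polyrun_step reg_bound d _ _ _ (fun x => nth 0 (v x) r ^ e + e)) => // [|x|x].
  - have /andP[w1 s1] : wf_cmd reg_bound (add_power 9 e r d) && static d (add_power 9 e r d).
      by apply: add_power_static => //; rewrite /reg_bound; lia.
    have /andP[w2 s2] : wf_cmd reg_bound (add_const d e) && static d (add_const d e).
      by apply: add_const_static; rewrite /reg_bound; lia.
    by rewrite /= w1 w2 s1.
  - rewrite /= run_add_power // => [|j /andP[le9 _]]; last by rewrite /= nth_default ?sv //; lia.
    by rewrite run_add_const setr_set /= eqxx nth_default ?sv.
  - by rewrite -hv set_nthE sv ltnn subnn /= cats1.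
have addc d e (v v' : seq bool -> seq nat) : d < 9 -> poly_bounded (fun x => sumn (v x)) ->
    (forall x, set_nth 0 (v x) d (nth 0 (v x) d + e) = v' x) ->
    polyrun reg_bound (add_const d e) (fun x => mkstate (v x) [::]) (fun x => mkstate (v' x) [::]).
  move=> ltd pv; apply: polyrun_step => // [|x]; last by rewrite run_add_const.
  by apply: (@add_const_static reg_bound); rewrite /reg_bound; lia.
have addl d r e (v v' : seq bool -> seq nat) : d < 6 -> r < 6 -> r != d ->
    (forall x, size (v x) <= 6) -> poly_bounded (fun x => sumn (v x)) ->
    (forall x, set_nth 0 (v x) d (nth 0 (v x) d + e * nth 0 (v x) r) = v' x) ->
    polyrun reg_bound (For 6 r (add_const d e)) (fun x => mkstate (v x) [::])
      (fun x => mkstate (v' x) [::]).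
  move=> ltd ltr ne sv pv; apply: (@polyrun_step reg_bound) => // [|x]; last first.
    by rewrite run_for_add_const //= ?nth_default //; lia.
  have /andP[w1 s1] : wf_cmd reg_bound (add_const d e) && static d (add_const d e).
    by apply: add_const_static; rewrite /reg_bound; lia.
  have pre j : j != d -> preserves j (add_const d e).
    by move=> nj; elim: (e) => //= e' ->; rewrite eq_sym nj.
  by rewrite /= w1 s1 !pre //; rewrite /reg_bound; lia.
have -> : init_state = fun x => mkstate [:: size x] [::].
  apply: functional_extensionality => x; congr (_, _).
  by apply: functional_extensionality => -[|[|r]].
pose n (x : seq bool) := size x; pose P x := cert_size l (n x); pose m x := row_input l (n x).
pose T x := run_time k l (n x); pose c x := margin k l (n x).
apply: (@polyrun_seq (fun x => mkstate [:: n x; P x] [::])).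
  by apply: power => //; [lia|poly].
apply: (@polyrun_seq (fun x => mkstate [:: n x; P x; 2 * n x] [::])).
  by apply: addl => //; poly.
apply: (@polyrun_seq (fun x => mkstate [:: n x; P x; 2 * n x + 1 * P x] [::])).
  by apply: addl => //; poly.
apply: (@polyrun_seq (fun x => mkstate [:: n x; P x; m x] [::])).
  by apply: addc => //; poly.
apply: (@polyrun_seq (fun x => mkstate [:: n x; P x; m x; T x] [::])).
  by apply: power => //; [lia|poly].
apply: (@polyrun_seq (fun x => mkstate [:: n x; P x; m x; T x; 2 * T x] [::])).
  by apply: addl => //; poly.
apply: (@polyrun_seq (fun x => mkstate [:: n x; P x; m x; T x; c x] [::])).
  by apply: addc => //; poly.
apply: (@polyrun_seq (fun x => mkstate [:: n x; P x; m x; T x; c x; 2 * c x] [::])).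
  by apply: addl => //; poly.
by apply: addl => //; poly.
Qed.

End Program.

(** * The reduction runs in polynomial time *)

Lemma flatten_flatten (T : Type) (sss : seq (seq (seq T))) :
  flatten (flatten sss) = flatten (map flatten sss).
Proof. by elim: sss => //= ss sss IH; rewrite flatten_cat IH. Qed.

Section Printing.
Variables (M : TM) (k l : nat).
Local Notation tile := (tile M).
Local Notation code := (@tile_code M).

Definition cell_tpl (g : seq tile) (ei et : expr) : seq ftemplate :=
  [seq (pval, [:: ei; et; ([::], code a)]) | a <- g] ++
  [seq (psep, [:: ei; et; ([::], code a); ([::], code b)]) | a <- enum {: tile}, b <- enum {: tile}].

(** Register 4 is the margin and 6 the loop counter, so [[:: 4; 6; 6]] is the column of the first
    copy of the bit. *)
Definition bit_tpl (b : bool) : seq ftemplate :=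
  cell_tpl [:: PX M b] ([:: 4; 6; 6], 0) ([::], 0) ++
  cell_tpl [:: PX M b] ([:: 4; 6; 6], 1) ([::], 0).

Definition sep_tpl : seq ftemplate :=
  cell_tpl [:: PX M false] ([:: 4; 0; 0], 0) ([::], 0) ++
  cell_tpl [:: PX M true] ([:: 4; 0; 0], 1) ([::], 0).

Definition succ_tpl : seq ftemplate := [:: (psucc, [:: ([:: 6], 0); ([:: 6], 1)])].

Definition forb_tpl : seq ftemplate :=
  [seq (pforb, [seq ([::], code a) | a <- [:: q.1.1; q.1.2; q.2.1; q.2.2]]) | q <- forb_args M].

Definition print_cmd : cmd :=
  Seq (For 6 4 (out_facts 8 (cell_tpl [:: PB M] ([:: 6], 0) ([::], 0))))
  (Seq (For 6 0 (IfBit 6 (out_facts 8 (bit_tpl true)) (out_facts 8 (bit_tpl false))))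
  (Seq (out_facts 8 sep_tpl)
  (Seq (For 6 1 (out_facts 8 (cell_tpl (guess M) ([:: 4; 0; 0; 6], 2) ([::], 0))))
  (Seq (For 6 4 (out_facts 8 (cell_tpl [:: PB M] ([:: 4; 2; 6], 0) ([::], 0))))
  (Seq (For 7 4 (For 6 5 (out_facts 8 (cell_tpl (enum {: tile}) ([:: 6], 0) ([:: 7], 1)))))
  (Seq (For 6 5 (out_facts 8 succ_tpl))
  (Seq (out_facts 8 forb_tpl) (Out false)))))))).

Lemma feval_cell_tpl s g ei et :
  map (feval s) (cell_tpl g ei et) = cell_facts g (eval s ei) (eval s et).
Proof. by rewrite map_cat map_allpairs -map_comp. Qed.

Lemma run_seq x c1 c2 s : run x (Seq c1 c2) s = run x c2 (run x c1 s).
Proof. by []. Qed.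

(** Each printing command produces one block of [cells] or of the remaining facts, so the two sides
    are matched block by block. *)
Lemma run_print x :
  run x print_cmd (dims_state k l (size x)) = appo (dims_state k l (size x)) (enc_db (db M k l x)).
Proof.
rewrite /print_cmd /dims_state; set v := dims k l (size x).
have out (i r : nat) ts o : 5 < i -> i != 8 ->
    run x (For i r (out_facts 8 ts)) (mkstate v o) =
    mkstate v (o ++ enc_facts (flatten [seq map (feval (mkstate (set_nth 0 v i j) [::])) ts |
      j <- iota 0 (nth 0 v r)])).
  move=> lti ne; have v0 j : 5 < j -> (mkstate v o).1 j = 0 by move=> h; rewrite /= nth_default.
  rewrite run_for_facts; [|exact: v0|exact: v0|by rewrite eq_sym].
  apply: (congr1 (fun D => mkstate v (o ++ enc_facts (flatten D)))).
  by apply: eq_map => j; rewrite -setr_mkstate.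
have out1 ts o : run x (out_facts 8 ts) (mkstate v o) =
    mkstate v (o ++ enc_facts (map (feval (mkstate v [::])) ts)).
  by rewrite run_out_facts.
have outb o : run x (For 6 0 (IfBit 6 (out_facts 8 (bit_tpl true)) (out_facts 8 (bit_tpl false))))
      (mkstate v o) =
    mkstate v (o ++ enc_facts (flatten [seq map (feval (mkstate (set_nth 0 v 6 j) [::]))
      (bit_tpl (nth false x j)) | j <- iota 0 (size x)])).
  rewrite enc_facts_flatten -map_comp; apply: run_for_out => // j o' _.
  have ss : (setr (mkstate v o) 6 j).1 = (mkstate (set_nth 0 v 6 j) [::]).1.
    by rewrite setr_mkstate.
  have run_if c1 c2 s : run x (IfBit 6 c1 c2) s =
    if nth false x (s.1 6) then run x c1 s else run x c2 s by [].
  rewrite ss run_if.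
  have -> : ((mkstate (set_nth 0 v 6 j) [::]).1, o').1 6 = j by [].
  by case: (nth false x j); rewrite run_out_facts.
have outr o : run x (For 7 4 (For 6 5 (out_facts 8 (cell_tpl (enum {: tile}) ([:: 6], 0) ([:: 7], 1)))))
      (mkstate v o) =
    mkstate v (o ++ enc_facts (flatten [seq flatten [seq
      map (feval (mkstate (set_nth 0 (set_nth 0 v 7 t) 6 j) [::]))
        (cell_tpl (enum {: tile}) ([:: 6], 0) ([:: 7], 1)) |
        j <- iota 0 (row_size k l (size x))] | t <- iota 0 (margin k l (size x))])).
  rewrite enc_facts_flatten -map_comp; apply: run_for_out => // t o' _.
  have ss : (setr (mkstate v o) 7 t).1 = (mkstate (set_nth 0 v 7 t) [::]).1.
    by rewrite setr_mkstate.
  rewrite ss -[LHS]/(run x _ (mkstate (set_nth 0 v 7 t) o')) run_for_facts //.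
  apply: (congr1 (fun D => mkstate (set_nth 0 v 7 t) (o' ++ enc_facts (flatten D)))).
  by apply: eq_map => j; rewrite setr_mkstate.
do 4!(rewrite run_seq; first [rewrite out // | rewrite outb | rewrite out1]).
rewrite run_seq out // run_seq outr run_seq out // run_seq out1.
rewrite cat0s -!enc_facts_cat -!catA.
set D := _ ++ _; suff -> : db M k l x = D by [].
rewrite {}/D /db /cells map_cat flatten_cat -catA; congr (_ ++ _).
  rewrite -map_comp; congr flatten; apply: eq_map => j; rewrite feval_cell_tpl.
  by congr cell_facts; rewrite /eval /= !addn0.
rewrite map_cat flatten_cat -catA; congr (_ ++ _).
  rewrite map_flatten flatten_flatten -!map_comp; congr flatten; apply: eq_map => j.
  rewrite /bit_tpl map_cat !feval_cell_tpl.
  rewrite -[LHS]/(cell_facts _ _ _ ++ (cell_facts _ _ _ ++ [::])) cats0.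
  by congr (_ ++ _); congr cell_facts; rewrite /eval /= !addn0.
rewrite map_cat flatten_cat -catA; congr (_ ++ _).
  rewrite /sep_tpl map_cat !feval_cell_tpl.
  rewrite -[LHS]/(cell_facts _ _ _ ++ (cell_facts _ _ _ ++ [::])) cats0.
  by congr (_ ++ _); congr cell_facts; rewrite /eval /= !addn0.
rewrite map_cat flatten_cat -catA; congr (_ ++ _).
  rewrite -map_comp; congr flatten; apply: eq_map => j; rewrite feval_cell_tpl.
  by congr cell_facts; rewrite /eval /= !addn0.
rewrite map_cat flatten_cat -catA; congr (_ ++ _).
  rewrite -map_comp; congr flatten; apply: eq_map => j; rewrite feval_cell_tpl.
  by congr cell_facts; rewrite /eval /= !addn0.
congr (_ ++ _).
  rewrite map_flatten flatten_flatten -!map_comp; congr flatten; apply: eq_map => t /=.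
  rewrite -map_comp; congr flatten; apply: eq_map => j; rewrite feval_cell_tpl.
  by congr cell_facts; rewrite /eval /= !addn0.
congr (_ ++ _).
  rewrite /succ_tpl; elim: (iota 0 _) => //= j js ->.
  by rewrite /feval /eval /= !addn0.
by rewrite -map_comp.
Qed.

Lemma regs_cell_tpl g ei et r : r \in regs (cell_tpl g ei et) -> (r \in ei.1) || (r \in et.1).
Proof.
case/flatten_mapP=> t; rewrite mem_cat => /orP[/mapP[a _ ->]|/allpairsP[a [_ _ ->]]];
  by rewrite /= ?cats0 mem_cat.
Qed.

(** The program has no [Inc], and register 8 is just the counter of the unary printer and bounds no
    loop, so it can take the place of the growing register. *)
Lemma print_static : wf_cmd (reg_bound k l) print_cmd && static 8 print_cmd.
Proof.
have bnd r : r < 9 -> r <= reg_bound k l by rewrite /reg_bound; lia.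
have st ts : {in regs ts, forall r, r < 8} ->
    wf_cmd (reg_bound k l) (out_facts 8 ts) && static 8 (out_facts 8 ts).
  move=> h; apply: out_facts_static => // r /h ltr; rewrite /reg_bound; lia.
have pre j ts : j < 8 -> preserves j (out_facts 8 ts).
  by move=> ltj; apply: preserves_out_facts; lia.
have cell g ei et : all (fun r => r < 8) (ei.1 ++ et.1) ->
    {in regs (cell_tpl g ei et), forall r, r < 8}.
  by move=> /allP h r /regs_cell_tpl; rewrite -mem_cat => /h.
have cat ts1 ts2 : {in regs ts1, forall r, r < 8} -> {in regs ts2, forall r, r < 8} ->
    {in regs (ts1 ++ ts2), forall r, r < 8}.
  by move=> h1 h2 r; rewrite /regs map_cat flatten_cat mem_cat => /orP[/h1|/h2].
have /andP[w1 s1] := st _ (cell [:: PB M] ([:: 6], 0) ([::], 0) isT).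
have bit b : wf_cmd (reg_bound k l) (out_facts 8 (bit_tpl b)) && static 8 (out_facts 8 (bit_tpl b)).
  by apply: st; apply: cat; apply: cell.
have /andP[w2 s2] := bit true; have /andP[w3 s3] := bit false.
have /andP[w4 s4] : wf_cmd (reg_bound k l) (out_facts 8 sep_tpl) && static 8 (out_facts 8 sep_tpl).
  by apply: st; apply: cat; apply: cell.
have /andP[w5 s5] := st _ (cell (guess M) ([:: 4; 0; 0; 6], 2) ([::], 0) isT).
have /andP[w6 s6] := st _ (cell [:: PB M] ([:: 4; 2; 6], 0) ([::], 0) isT).
have /andP[w7 s7] := st _ (cell (enum {: tile}) ([:: 6], 0) ([:: 7], 1) isT).
have /andP[w8 s8] : wf_cmd (reg_bound k l) (out_facts 8 succ_tpl) && static 8 (out_facts 8 succ_tpl).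
  by apply: st => r; rewrite !inE => /orP[]/eqP->.
have /andP[w9 s9] : wf_cmd (reg_bound k l) (out_facts 8 forb_tpl) && static 8 (out_facts 8 forb_tpl).
  apply: st => r /flatten_mapP[t /mapP[q _ ->]] /flatten_mapP[e /mapP[a _ ->]].
  by [].
rewrite /print_cmd; cbn [wf_cmd static preserves].
by rewrite w1 w2 w3 w4 w5 w6 w7 w8 w9 s1 s2 s3 s4 s5 s6 s7 s8 s9 !pre ?bnd.
Qed.

Lemma print_db_polytime : polytime (fun x => enc_db (db M k l x)).
Proof.
have [w hrun [e he]] : polyrun (reg_bound k l) (Seq (dims_cmd k l) print_cmd) init_state
    (fun x => appo (dims_state k l (size x)) (enc_db (db M k l x))).
  apply: polyrun_seq (polyrun_dims k l) _.
  have /andP[w s] := print_static; apply: (polyrun_static w s) => [|x]; last exact: run_print.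
  by poly.
pose U n := (n + 2) ^ e; pose T n := U n * (2 * (n + U n) + 2) + 1.
have hN := machine_computes (T := U) w (fun x => congr1 snd (hrun x)) he.
have [d hd] : exists d, forall x : seq bool, T (size x) <= size x ^ d + d.
  by apply: (@poly_bounded_time (fun x => T (size x))); rewrite /T /U; poly.
exists (machine (compile (reg_bound k l) 0 (Seq (dims_cmd k l) print_cmd))), d => x.
have [n [len h]] := hN x.
by exists n; split=> //; apply: leq_trans len (hd x).
Qed.
End Printing.

Theorem theorem15 :
  exists (S : signature) (Sigma : seq dep) (q : cq),
    wf_sig S /\
    (forall t, List.In t Sigma -> wf_dep S t) /\
    acyclic Sigma /\
    (forall t, List.In t Sigma -> full t) /\
    (forall t, List.In t Sigma -> guarded t) /\
    sticky Sigma /\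
    safe_bcq S q /\
    coNP_hard (wf_db S) (fun D => AR_entails Sigma D q) enc_db.
Proof.
exists tab_sig, tab_rules, tab_query.
split; first exact: wf_tab_sig.
split; first exact: wf_tab_rules.
split; first exact: acyclic_tab_rules.
split; first exact: full_tab_rules.
split; first exact: guarded_tab_rules.
split; first exact: sticky_tab_rules.
split; first exact: safe_tab_query.
move=> L [V [l [[F [[M [k hM]] hF]] hV]]].
exists (db M k l); split; first exact: print_db_polytime.
split=> x; first exact: wf_db_db.
(* [V] verifies the complement of [L], so the absence of certificates gives [L x] only up to a
   double negation. *)
rewrite (AR_entails_db l x hM); split=> [Lx [y [ley /hF hy]]|none].
  by have /hV : exists y, size y <= size x ^ l + l /\ V (pair_enc x y) by exists y.
apply: NNPP => /hV[y [ley /hF hy]]; apply: none.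
by exists y.
Qed.
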